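(* Let $G$ be a connected, simply connected complex unipotent Lie group, and let $V,H\subset G$ be complex algebraic subgroups with $\dim V=1=\dim H$ such that the $V\times H$-action on $G$ given by $(v,h).g=vgh^{-1}$ is free. Then there is a global slice of the $V\times H$-action on $G$ isomorphic to $\mathbb{C}^{\dim G-2}$.
   Context: A complex unipotent Lie group is an algebraic subgroup of a group of (unipotent) upper triangular complex matrices. A global slice of the $V\times H$-action on $G$ is a closed algebraic subvariety $S\subset G$ such that the map $V\times S\times H\to G$, $(v,s,h)\mapsto vsh$, is an isomorphism of algebraic varieties. *)

(* Defs.v *)
(* MathComp-Analysis; the complex numbers are R[i] for a realType R. *)
From HB Require Import structures.
From mathcomp Require Import all_boot all_order all_algebra.
From mathcomp Require Import all_classical all_reals all_analysis.
From mathcomp Require Import complex.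
(* Not imported: the notations of mpoly clash with those of MathComp-Analysis. *)
From mathcomp Require mpoly.

Set Implicit Arguments.
Unset Strict Implicit.
Unset Printing Implicit Defensive.

Import Order.TTheory GRing.Theory Num.Theory numFieldNormedType.Exports.

Local Open Scope classical_set_scope.
Local Open Scope ring_scope.

(* Typed as a numFieldType so that the norm topology on C, and hence the
   Euclidean topology on matrices over C, is inferred. *)
Definition Cplx (R : realType) : numFieldType := complex R.

Section Topology.
Variables (R : realType) (T : topologicalType).

Definition unit_itv : set R := [set t | 0 <= t <= 1].

Definition path_connected (X : set T) : Prop :=
  forall x y, X x -> X y ->
  exists f : R -> T,
    [/\ {within unit_itv, continuous f}, (forall t, unit_itv t -> X (f t)),
        f 0 = x & f 1 = y].

Definition null_homotopic_in (X : set T) (f : R -> T) : Prop :=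
  exists F : R * R -> T,
    [/\ {within unit_itv `*` unit_itv, continuous F},
        (forall p, (unit_itv `*` unit_itv) p -> X (F p)),
        (forall t, unit_itv t -> F (t, 0) = f t /\ F (t, 1) = f 0) &
        (forall s, unit_itv s -> F (0, s) = f 0 /\ F (1, s) = f 0)].

Definition simply_connected (X : set T) : Prop :=
  path_connected X /\
  forall f : R -> T,
    {within unit_itv, continuous f} -> (forall t, unit_itv t -> X (f t)) ->
    f 0 = f 1 -> null_homotopic_in X f.

End Topology.

Section AffineVarieties.
Variable K : fieldType.

Definition eval_at m (x : 'rV[K]_m) (p : mpoly.mpoly m K) : K :=
  mpoly.meval (fun i => x 0 i) p.

Definition zero_set m (I : set (mpoly.mpoly m K)) : set 'rV[K]_m :=
  [set x | forall p, I p -> eval_at x p = 0].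

Definition algebraic_set m (X : set 'rV[K]_m) : Prop :=
  exists I, X = zero_set I.

(* Morphisms between closed subvarieties of affine spaces are the restrictions
   of polynomial maps of the ambient spaces. *)
Definition variety_morphism m k (X : set 'rV[K]_m) (Y : set 'rV[K]_k)
    (f : 'rV[K]_m -> 'rV[K]_k) : Prop :=
  (forall x, X x -> Y (f x)) /\
  exists p : 'I_k -> mpoly.mpoly m K,
    forall x, X x -> forall j, f x 0 j = eval_at x (p j).

Definition variety_iso m k (X : set 'rV[K]_m) (Y : set 'rV[K]_k)
    (f : 'rV[K]_m -> 'rV[K]_k) : Prop :=
  variety_morphism X Y f /\
  exists g : 'rV[K]_k -> 'rV[K]_m,
    [/\ variety_morphism Y X g, (forall x, X x -> g (f x) = x) &
        (forall y, Y y -> f (g y) = y)].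

Definition isomorphic m k (X : set 'rV[K]_m) (Y : set 'rV[K]_k) : Prop :=
  exists f, variety_iso X Y f.

Definition affine_prod m k (X : set 'rV[K]_m) (Y : set 'rV[K]_k) :
    set 'rV[K]_(m + k) :=
  [set z | X (lsubmx z) /\ Y (rsubmx z)].

Definition irreducible_set m (Z : set 'rV[K]_m) : Prop :=
  Z !=set0 /\
  forall A B, algebraic_set A -> algebraic_set B ->
    Z `<=` A `|` B -> Z `<=` A \/ Z `<=` B.

(* Strict chains Z_0 < ... < Z_k of irreducible closed subsets of X. *)
Definition has_irreducible_chain m (X : set 'rV[K]_m) (k : nat) : Prop :=
  exists Z : nat -> set 'rV[K]_m,
    (forall i, (i <= k)%N ->
       [/\ algebraic_set (Z i), irreducible_set (Z i) & Z i `<=` X]) /\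
    (forall i, (i < k)%N -> Z i `<` Z i.+1).

Definition has_dim m (X : set 'rV[K]_m) (d : nat) : Prop :=
  has_irreducible_chain X d /\
  forall k, has_irreducible_chain X k -> (k <= d)%N.

End AffineVarieties.

Section UnipotentGroups.
Variables (K : fieldType) (n : nat).

(* A set of n x n matrices viewed in the affine space of dimension n * n. *)
Definition mxset (X : set 'M[K]_n) : set 'rV[K]_(n * n) := mxvec @` X.

Definition unipotent_upper (A : 'M[K]_n) : Prop :=
  forall i j : 'I_n, (j <= i)%N -> A i j = (i == j)%:R.

Definition matrix_group (G : set 'M[K]_n) : Prop :=
  [/\ G `<=` [set A | A \in unitmx], G 1%:M,
      (forall A B, G A -> G B -> G (A *m B)) &
      (forall A, G A -> G (invmx A))].

Definition algebraic_group (G : set 'M[K]_n) : Prop :=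
  matrix_group G /\ algebraic_set (mxset G).

Definition unipotent_group (G : set 'M[K]_n) : Prop :=
  algebraic_group G /\ G `<=` unipotent_upper.

Definition algebraic_subgroup (H G : set 'M[K]_n) : Prop :=
  algebraic_group H /\ H `<=` G.

Definition two_sided_act (v h g : 'M[K]_n) : 'M[K]_n := v *m g *m invmx h.

Definition free_action (V H G : set 'M[K]_n) : Prop :=
  forall v h g, V v -> H h -> G g ->
    two_sided_act v h g = g -> v = 1%:M /\ h = 1%:M.

(* (v, s, h) |-> v s h in vectorized coordinates. *)
Definition slice_map (z : 'rV[K]_(n * n + (n * n + n * n))) : 'rV[K]_(n * n) :=
  mxvec (vec_mx (lsubmx z) *m vec_mx (lsubmx (rsubmx z))
         *m vec_mx (rsubmx (rsubmx z))).

Definition global_slice (V H G S : set 'M[K]_n) : Prop :=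
  [/\ S `<=` G, algebraic_set (mxset S) &
      variety_iso (affine_prod (mxset V) (affine_prod (mxset S) (mxset H)))
        (mxset G) slice_map].

End UnipotentGroups.

(* Main.v *)
(* Write G = exp g with g a Lie algebra of strictly upper triangular matrices,
   V = exp(C v), H = exp(C h), and let N_k be the strictly upper triangular
   matrices supported on and above the k-th superdiagonal, so that
   [g, N_k] lies in N_(k+1).  Freeness says that no conjugate of C h meets C v.
   Let m be the last index such that this fails modulo N_m; conjugating H, some
   nontrivial combination z = b h - a v lies in N_m.  Put w = a v.  If z = [w, x]
   modulo N_(m+1), then Ad(exp(-x)) w = w + z = b h there, against the choice of
   m.  So some linear form xi has xi(z) = 1 and kills [w, g] and N_(m+1); since z
   is central modulo N_(m+1), xi o log increases by t under
   g |-> exp(-t a v) g exp(t b h).  Choose the largest i such that v and h lie in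
   N_i + C z, and a form eta killing N_(i+1) + C z with (eta v, eta h) = (b, a):
   then eta o log changes by b s + a t under g |-> exp(s v) g exp(t h).  Hence
   exp(g /\ ker xi /\ ker eta) is a slice, and log identifies it with a linear
   space of dimension dim g - 2.

   No Baker-Campbell-Hausdorff formula is needed: exp and log are only compared
   modulo the N_k.  That the Krull dimension of an affine space is its linear
   dimension is shown by counting: a chain of k + 1 irreducible closed sets
   yields N^k linearly independent polynomial functions of degree O(N). *)

Require Import Defs.
From mathcomp Require Import all_boot all_order all_algebra.
From mathcomp Require Import all_classical all_reals all_analysis.
From mathcomp Require Import complex.
From mathcomp Require Import ring zify.
Import -(notations) mpoly.
Import numFieldNormedType.Exports.
Import Order.TTheory GRing.Theory Num.Theory.

Set Implicit Arguments.
Unset Strict Implicit.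
Unset Printing Implicit Defensive.

(** * Exponential and logarithm of triangular matrices *)

Section Filtration.
Local Open Scope ring_scope.
Variables (K : numFieldType) (n : nat).
Implicit Types (X Y Z A B : 'M[K]_n).

(** For [k = 0] these are the upper triangular matrices, for [k = 1] the strictly upper triangular
    ones. Congruence modulo N_k is always expressed as [above_diag k] of a difference. *)
Definition above_diag (k : nat) (X : 'M[K]_n) : Prop :=
  forall i j : 'I_n, (j < i + k)%N -> X i j = 0.

Lemma above_diag0 k : above_diag k 0.
Proof. by move=> i j _; rewrite mxE. Qed.

Lemma above_diagD k X Y :
  above_diag k X -> above_diag k Y -> above_diag k (X + Y).
Proof. by move=> hX hY i j ij; rewrite mxE hX // hY // addr0. Qed.

Lemma above_diagZ k c X : above_diag k X -> above_diag k (c *: X).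
Proof. by move=> hX i j ij; rewrite mxE hX // mulr0. Qed.

Lemma above_diagN k X : above_diag k X -> above_diag k (- X).
Proof. by rewrite -scaleN1r; apply: above_diagZ. Qed.

Lemma above_diagB k X Y :
  above_diag k X -> above_diag k Y -> above_diag k (X - Y).
Proof. by move=> hX hY; apply: above_diagD => //; apply: above_diagN. Qed.

Lemma above_diagBC k X Y : above_diag k (X - Y) -> above_diag k (Y - X).
Proof. by move=> /above_diagN; rewrite opprB. Qed.

Lemma above_diag_sum k (I : Type) (r : seq I) (P : pred I) (F : I -> 'M[K]_n) :
  (forall i, P i -> above_diag k (F i)) -> above_diag k (\sum_(i <- r | P i) F i).
Proof.
by move=> h; apply: (big_ind (above_diag k)) => //;
  [exact: above_diag0 | exact: above_diagD].
Qed.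

Lemma above_diagW k l X : (l <= k)%N -> above_diag k X -> above_diag l X.
Proof.
by move=> lk hX i j ij; apply: hX; apply: leq_trans ij _; rewrite leq_add2l.
Qed.

Lemma above_diagM k l X Y :
  above_diag k X -> above_diag l Y -> above_diag (k + l) (X *m Y).
Proof.
move=> hX hY i j ij; rewrite mxE big1 // => m _.
have [mik|mik] := ltnP m (i + k); first by rewrite hX // mul0r.
rewrite hY ?mulr0 //; apply: leq_trans ij _.
by rewrite addnA leq_add2r.
Qed.

Lemma above_diagMr k X Y :
  above_diag k X -> above_diag 0 Y -> above_diag k (X *m Y).
Proof. by move=> hX hY; rewrite -[k]addn0; apply: above_diagM. Qed.

Lemma above_diagMl k X Y :
  above_diag 0 X -> above_diag k Y -> above_diag k (X *m Y).
Proof. by move=> hX hY; rewrite -[k]add0n; apply: above_diagM. Qed.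

Lemma above_diag1 : above_diag 0 1%:M.
Proof.
move=> i j; rewrite addn0 mxE => ji.
by case: eqP => // eij; rewrite eij ltnn in ji.
Qed.

Lemma above_diag_eq0 k X : (n <= k)%N -> above_diag k X -> X = 0.
Proof.
move=> nk hX; apply/matrixP => i j; rewrite mxE hX //.
by apply: leq_trans (ltn_ord j) _; apply: leq_trans nk _; apply: leq_addl.
Qed.

Lemma mulmx_pow0 X : X ^+ 0 = 1%:M. Proof. by []. Qed.
Lemma mulmx_powS X k : X ^+ k.+1 = X *m X ^+ k. Proof. exact: exprS. Qed.
Lemma mulmx_powSr X k : X ^+ k.+1 = X ^+ k *m X. Proof. exact: exprSr. Qed.

Lemma above_diagX k X : above_diag 1 X -> above_diag k (X ^+ k).
Proof.
move=> hX; elim: k => [|k IH]; first exact: above_diag1.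
by rewrite mulmx_powS -add1n; apply: above_diagM.
Qed.

(** * Truncated exponential and its inverse *)

Definition divpow (k : nat) (X : 'M[K]_n) : 'M[K]_n := k`!%:R^-1 *: X ^+ k.

(** On strictly upper triangular matrices the n-th power vanishes, so this is the full exponential
    series; elsewhere it is merely a polynomial in X. *)
Definition expm (X : 'M[K]_n) : 'M[K]_n := \sum_(k < n) divpow k X.

Lemma divpow0 X : divpow 0 X = 1%:M.
Proof. by rewrite /divpow fact0 invr1 scale1r mulmx_pow0. Qed.

Lemma divpow1 X : divpow 1 X = X.
Proof. by rewrite /divpow invr1 scale1r expr1. Qed.

Lemma above_diag_divpow k X : above_diag 1 X -> above_diag k (divpow k X).
Proof. by move=> hX; apply/above_diagZ/above_diagX. Qed.

Lemma natS_neq0 k : k.+1%:R != 0 :> K.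
Proof. by rewrite pnatr_eq0. Qed.

Lemma mul_divpow k X : X *m divpow k X = k.+1%:R *: divpow k.+1 X.
Proof.
rewrite /divpow -scalemxAr scalerA mulmx_powS factS natrM invfM mulrA.
by rewrite mulfV ?natS_neq0 // mul1r.
Qed.

Lemma divpow_mul k X : divpow k X *m X = k.+1%:R *: divpow k.+1 X.
Proof.
rewrite /divpow -scalemxAl scalerA mulmx_powSr factS natrM invfM mulrA.
by rewrite mulfV ?natS_neq0 // mul1r.
Qed.

Lemma mulmx_powZ c X k : (c *: X) ^+ k = c ^+ k *: X ^+ k.
Proof.
elim: k => [|k IH]; first by rewrite !expr0 scale1r.
by rewrite !mulmx_powS IH exprS -scalemxAl -scalemxAr scalerA.
Qed.

Lemma divpowZ c k X : divpow k (c *: X) = c ^+ k *: divpow k X.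
Proof. by rewrite /divpow mulmx_powZ !scalerA mulrC. Qed.

Lemma expm_widen m X :
  above_diag 1 X -> (n <= m)%N -> \sum_(k < m) divpow k X = expm X.
Proof.
move=> hX nm; rewrite /expm -!(big_mkord xpredT (fun k => divpow k X)).
rewrite (@big_cat_nat _ _ _ n) //= -[RHS]addr0; congr (_ + _).
rewrite big_nat big1 // => k /andP[nk _].
by apply: above_diag_eq0 nk _; apply: above_diag_divpow.
Qed.

Lemma expm_decomp X : above_diag 1 X ->
  expm X = 1%:M + X + \sum_(k < n) divpow k.+2 X.
Proof.
move=> hX; rewrite -(@expm_widen n.+2) //; last by rewrite -addn2 leq_addr.
by rewrite !big_ord_recl addrA divpow0 divpow1.
Qed.

Lemma expm0 : expm 0 = 1%:M.
Proof.
rewrite expm_decomp; last exact: above_diag0.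
rewrite big1 ?addr0 // => k _.
by rewrite /divpow mulmx_powS mul0mx scaler0.
Qed.

(* Every other term of [expm (X + E)] involving E has a further factor X or E. *)
Lemma expm_congr_add k X E :
  (0 < k)%N -> above_diag 1 X -> above_diag k E ->
  above_diag k.+1 (expm (X + E) - expm X - E).
Proof.
move=> k0 hX hE.
have hE1 : above_diag 1 E by apply: above_diagW hE.
have hXE : above_diag 1 (X + E) by apply: above_diagD.
have pow_congr l : above_diag k.+1 ((X + E) ^+ l.+2 - X ^+ l.+2).
  elim: l => [|l IH].
    rewrite !mulmx_powS !mulmx_pow0 !mulmx1 mulmxDl !mulmxDr.
    have -> (a b c d : 'M[K]_n) : a + b + (c + d) - a = b + c + d.
      by apply/matrixP => i j; rewrite !mxE; ring.
    apply: above_diagD; first apply: above_diagD.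
    - by rewrite -add1n; apply: above_diagM.
    - by rewrite -addn1; apply: above_diagM.
    by apply: above_diagW (above_diagM hE hE); rewrite -addn1 leq_add2l.
  have -> : (X + E) ^+ l.+3 - X ^+ l.+3 =
      (X + E) *m ((X + E) ^+ l.+2 - X ^+ l.+2) + E *m X ^+ l.+2.
    rewrite [(X + E) ^+ l.+3]mulmx_powS [X ^+ l.+3]mulmx_powS mulmxBr.
    by rewrite [(X + E) *m X ^+ _]mulmxDl opprD addrA subrK.
  apply: above_diagD.
    by apply: above_diagMl => //; apply: above_diagW hXE.
  apply: above_diagW (above_diagM hE (above_diagX (k := l.+2) hX)).
  by rewrite -addn1 leq_add2l.
rewrite !expm_decomp //.
have -> (a x e s t : 'M[K]_n) : a + (x + e) + s - (a + x + t) - e = s - t.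
  by apply/matrixP => i j; rewrite !mxE; ring.
rewrite -sumrB; apply: above_diag_sum => l _.
by rewrite /divpow -scalerBr; apply: above_diagZ.
Qed.

Lemma expm_congr k X Y :
  (0 < k)%N -> above_diag 1 X -> above_diag k (Y - X) ->
  above_diag k (expm Y - expm X).
Proof.
move=> k0 hX hE; have := expm_congr_add k0 hX hE; rewrite (addrC X) subrK => h.
rewrite -[expm Y - expm X](subrK (Y - X)); apply: above_diagD => //.
exact: above_diagW h.
Qed.

Lemma expm_unipotent X : above_diag 1 X -> above_diag 1 (expm X - 1%:M).
Proof.
move=> hX; rewrite -expm0; apply: expm_congr => //; first exact: above_diag0.
by rewrite subr0.
Qed.

Lemma unipotent_above_diag0 A : above_diag 1 (A - 1%:M) -> above_diag 0 A.
Proof.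
move=> hA; rewrite -[A](subrK 1%:M); apply: above_diagD; last exact: above_diag1.
exact: above_diagW hA.
Qed.

Lemma expm_above_diag0 X : above_diag 1 X -> above_diag 0 (expm X).
Proof. by move/expm_unipotent/unipotent_above_diag0. Qed.

Lemma unipotentM A B :
  above_diag 1 (A - 1%:M) -> above_diag 1 (B - 1%:M) ->
  above_diag 1 (A *m B - 1%:M).
Proof.
move=> hA hB.
have -> : A *m B - 1%:M = (A - 1%:M) *m B + (B - 1%:M).
  by rewrite mulmxBl mul1mx addrA subrK.
by apply: above_diagD => //; apply: above_diagMr => //;
  exact: unipotent_above_diag0.
Qed.

(** Once Y - X lies in N_k with k > 0, it agrees with exp Y - exp X modulo N_(k+1), so each
    induction step gains one diagonal. *)
Lemma expm_inj_congr k X Y :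
  above_diag 1 X -> above_diag 1 Y ->
  above_diag k (expm Y - expm X) -> above_diag k (Y - X).
Proof.
move=> hX hY; elim: k => [|k IH] h.
  by apply: above_diagW (above_diagB hY hX).
have hk : above_diag k (Y - X) by apply: IH; apply: above_diagW h.
(* [expm_congr_add] needs a positive index; the passage from 0 to 1 holds because X and Y are
   strictly triangular. *)
case: k => [|k] in hk h IH *; first exact: above_diagB.
have := expm_congr_add (ltn0Sn k) hX hk; rewrite (addrC X) subrK => h'.
rewrite -[Y - X](subKr (expm Y - expm X)); exact: above_diagB.
Qed.

Lemma expm_inj X Y : above_diag 1 X -> above_diag 1 Y ->
  expm X = expm Y -> X = Y.
Proof.
move=> hX hY e; apply/esym/eqP; rewrite -subr_eq0; apply/eqP.
apply: (@above_diag_eq0 n) => //; apply: expm_inj_congr => //.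
by rewrite e subrr; apply: above_diag0.
Qed.

(* Each step removes one more diagonal of the error, so
   this is an inverse of [expm] on unipotent matrices, polynomial in A. *)
Definition logm (A : 'M[K]_n) : 'M[K]_n := iter n (fun X => X + (A - expm X)) 0.

Lemma logm_iter A m : above_diag 1 (A - 1%:M) ->
  let X := iter m (fun X => X + (A - expm X)) 0 in
  above_diag 1 X /\ above_diag m.+1 (A - expm X).
Proof.
move=> hA; elim: m => [|m [IH1 IH2]] /=.
  by split; [exact: above_diag0 | rewrite expm0].
set X := iter m _ _ in IH1 IH2 *.
split.
  by apply: above_diagD => //; apply: above_diagW IH2.
have := expm_congr_add (ltn0Sn m) IH1 IH2.
move/above_diagN; congr (above_diag _ _).
by rewrite -addrA -opprD opprB [expm X + _]addrC subrK.
Qed.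

Lemma logmK A : above_diag 1 (A - 1%:M) -> expm (logm A) = A.
Proof.
move=> hA; have [_ h] := logm_iter n hA.
by apply/esym/eqP; rewrite -subr_eq0 (above_diag_eq0 _ h).
Qed.

Lemma logm_above_diag A : above_diag 1 (A - 1%:M) -> above_diag 1 (logm A).
Proof. by move=> hA; have [] := logm_iter n hA. Qed.

Lemma expmK X : above_diag 1 X -> logm (expm X) = X.
Proof.
move=> hX; have hA := expm_unipotent hX.
by apply: expm_inj => //; [exact: logm_above_diag | rewrite logmK].
Qed.

Lemma logm_congr k A B :
  above_diag 1 (A - 1%:M) -> above_diag 1 (B - 1%:M) ->
  above_diag k (A - B) -> above_diag k (logm A - logm B).
Proof.
move=> hA hB h; apply: expm_inj_congr; rewrite ?logmK //;
  exact: logm_above_diag.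
Qed.

(** First-order substitute for Baker-Campbell-Hausdorff: once the linear terms cancel, Z always
    meets another strictly triangular factor, which gains a diagonal. *)
Lemma mul_expm_congr k X Z :
  (0 < k)%N -> above_diag 1 X -> above_diag k Z ->
  above_diag k.+1 (expm X *m expm Z - expm (X + Z)).
Proof.
move=> k0 hX hZ; have hZ1 : above_diag 1 Z by apply: above_diagW hZ.
have h1 := expm_congr_add k0 hX hZ.
have h2 := expm_congr_add k0 (@above_diag0 1) hZ.
rewrite add0r expm0 in h2.
have -> : expm X *m expm Z - expm (X + Z) =
  expm X *m (expm Z - 1%:M - Z) + (expm X - 1%:M) *m Z
  - (expm (X + Z) - expm X - Z).
  rewrite mulmxBl mul1mx !mulmxBr mulmx1.
  rewrite [_ - _ - expm X *m Z]addrC.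
  have -> (a b c d e : 'M[K]_n) : - c + (a - b) + (c - d) - (e - b - d) = a - e.
    by apply/matrixP => i j; rewrite !mxE; ring.
  by [].
apply: above_diagB => //; apply: above_diagD.
  by apply: above_diagMl => //; apply: expm_above_diag0.
by rewrite -add1n; apply: above_diagM => //; apply: expm_unipotent.
Qed.

Lemma mul_expm_congrl k X Z :
  (0 < k)%N -> above_diag 1 X -> above_diag k Z ->
  above_diag k.+1 (expm Z *m expm X - expm (X + Z)).
Proof.
move=> k0 hX hZ; have hZ1 : above_diag 1 Z by apply: above_diagW hZ.
have h1 := expm_congr_add k0 hX hZ.
have h2 := expm_congr_add k0 (@above_diag0 1) hZ.
rewrite add0r expm0 in h2.
have -> : expm Z *m expm X - expm (X + Z) =
  (expm Z - 1%:M - Z) *m expm X + Z *m (expm X - 1%:M)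
  - (expm (X + Z) - expm X - Z).
  rewrite mulmxBr mulmx1 !mulmxBl mul1mx.
  rewrite [_ - _ - Z *m expm X]addrC.
  have -> (a b c d e : 'M[K]_n) : - c + (a - b) + (c - d) - (e - b - d) = a - e.
    by apply/matrixP => i j; rewrite !mxE; ring.
  by [].
apply: above_diagB => //; apply: above_diagD.
  by apply: above_diagMr => //; apply: expm_above_diag0.
by rewrite -addn1; apply: above_diagM => //; apply: expm_unipotent.
Qed.

(** * Divided powers, exponentials of sums and the adjoint action *)

Lemma sum_triangle (V : nmodType) m (F : nat -> nat -> V) :
  (forall i j, (m <= i + j)%N -> F i j = 0) ->
  \sum_(i < m) \sum_(j < m) F i j = \sum_(k < m) \sum_(i < k.+1) F i (k - i)%N.
Proof.
move=> F0.
transitivity (\sum_(0 <= i < m) \sum_(0 <= k < m | (i <= k)%N) F i (k - i)%N).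
  rewrite big_mkord; apply: eq_bigr => i _.
  rewrite -(big_nat_widenl _ _ _ predT) //= -{2}[nat_of_ord i]add0n big_addn.
  under [RHS]eq_bigr do rewrite addnK.
  rewrite -(big_mkord xpredT (F i)) (@big_cat_nat _ _ _ (m - i)) ?leq_subr //=.
  rewrite [X in _ + X]big_nat [X in _ + X]big1 ?addr0 // => j /andP[mij _].
  by apply: F0; rewrite -leq_subLR.
rewrite (exchange_big_dep_nat predT) //= big_mkord.
apply: eq_bigr => k _; rewrite -(big_mkord xpredT (fun i => F i (k - i)%N)).
by rewrite (@big_nat_widen _ _ _ 0 k.+1 m).
Qed.

(** The weights i and k + 1 - i of [G i] add up to k + 1. This is the Leibniz rule behind the
    recursions for divided powers of a sum and for [ad_divpow]. *)
Lemma sum_succ_weight (V : lmodType K) k (G : nat -> V) :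
  \sum_(i < k.+1) i.+1%:R *: G i.+1 + \sum_(i < k.+1) (k - i).+1%:R *: G i
    = k.+1%:R *: \sum_(i < k.+2) G i.
Proof.
rewrite big_ord_recr [X in _ + X]big_ord_recl /= subn0 scaler_sumr.
rewrite [RHS]big_ord_recl [X in _ = _ + X]big_ord_recr /=.
rewrite [X in _ + X = _]addrC addrACA [X in _ + X = _]addrC addrCA.
congr (_ + (_ + _)).
rewrite -big_split /=; apply: eq_bigr => i _.
rewrite /bump add1n -scalerDl -natrD.
by congr (_%:R *: _); have := ltn_ord i; lia.
Qed.

Lemma divpowD k X Y : X *m Y = Y *m X ->
  divpow k (X + Y) = \sum_(i < k.+1) divpow i X *m divpow (k - i) Y.
Proof.
move=> cXY; elim: k => [|k IH].
  by rewrite big_ord_recl big_ord0 addr0 !divpow0 mulmx1.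
apply: (scalerI (natS_neq0 k)); rewrite -mul_divpow IH.
rewrite -(sum_succ_weight k (fun i => divpow i X *m divpow (k.+1 - i) Y)).
rewrite mulmxDl !mulmx_sumr; congr (_ + _); apply: eq_bigr => i _.
  by rewrite mulmxA mul_divpow subSS -scalemxAl.
have -> : Y *m (divpow i X *m divpow (k - i) Y)
    = divpow i X *m (Y *m divpow (k - i) Y).
  rewrite !mulmxA; congr (_ *m _); rewrite /divpow -scalemxAr -scalemxAl.
  by congr (_ *: _); have := commrX i (esym cXY : GRing.comm Y X).
by rewrite mul_divpow -scalemxAr subSn // -ltnS.
Qed.

Lemma expmD X Y : above_diag 1 X -> above_diag 1 Y -> X *m Y = Y *m X ->
  expm (X + Y) = expm X *m expm Y.
Proof.
move=> hX hY cXY; rewrite {2}/expm mulmx_suml.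
under eq_bigr do rewrite mulmx_sumr.
rewrite (@sum_triangle _ _ (fun i j => divpow i X *m divpow j Y)).
  by apply: eq_bigr => k _; rewrite divpowD.
move=> i j nij; apply: above_diag_eq0 nij _.
by apply: above_diagM; apply: above_diag_divpow.
Qed.

Lemma expmZD a b X : above_diag 1 X ->
  expm ((a + b) *: X) = expm (a *: X) *m expm (b *: X).
Proof.
move=> hX; rewrite scalerDl expmD //; try exact: above_diagZ.
by rewrite -!scalemxAl -!scalemxAr scalerA mulrC -scalerA.
Qed.

Lemma expmN X : above_diag 1 X -> expm X *m expm (- X) = 1%:M.
Proof.
by move=> hX; rewrite -[X in expm X]scale1r -scaleN1r -expmZD // subrr scale0r expm0.
Qed.

Lemma expmNl X : above_diag 1 X -> expm (- X) *m expm X = 1%:M.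
Proof. by move=> hX; rewrite -{2}[X]opprK expmN //; apply: above_diagN. Qed.

(* (ad X)^k Y / k! *)
Definition ad_divpow (k : nat) X Y : 'M[K]_n :=
  \sum_(i < k.+1) divpow i X *m Y *m divpow (k - i) (- X).

Lemma ad_divpow0 X Y : ad_divpow 0 X Y = Y.
Proof.
by rewrite /ad_divpow big_ord_recl big_ord0 addr0 !divpow0 mulmx1 mul1mx.
Qed.

(** Multiplying by X on the left raises the left divided power, multiplying by - X on the right
    raises the right one. This recursion identifies [ad_divpow] with divided powers of ad X. *)
Lemma ad_divpowS k X Y : k.+1%:R *: ad_divpow k.+1 X Y =
  X *m ad_divpow k X Y - ad_divpow k X Y *m X.
Proof.
rewrite /ad_divpow
  -(sum_succ_weight k (fun i => divpow i X *m Y *m divpow (k.+1 - i) (- X))).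
rewrite mulmx_sumr mulmx_suml -sumrN; congr (_ + _); apply: eq_bigr => i _.
  by rewrite !mulmxA mul_divpow subSS -!scalemxAl.
rewrite -mulmxN -[RHS]mulmxA divpow_mul -[RHS]scalemxAr subSn //.
  by rewrite -ltnS ltn_ord.
Qed.

Lemma ad_divpowZ k c X Y : ad_divpow k (c *: X) Y = c ^+ k *: ad_divpow k X Y.
Proof.
rewrite /ad_divpow scaler_sumr; apply: eq_bigr => i _.
rewrite -scalerN !divpowZ; move: (divpow _ X) (divpow _ (- X)) => P Q.
rewrite -!scalemxAl -scalemxAr scalerA -exprD subnKC //.
by rewrite -ltnS.
Qed.

Lemma above_diag_ad_divpow k X Y :
  above_diag 1 X -> above_diag 0 Y -> above_diag k (ad_divpow k X Y).
Proof.
move=> hX hY; apply: above_diag_sum => i _.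
have ik : (i <= k)%N by rewrite -ltnS.
rewrite -{1}(subnKC ik); apply: above_diagM; last first.
  by apply: above_diag_divpow; apply: above_diagN.
by apply: above_diagMr => //; apply: above_diag_divpow.
Qed.

(** Ad(exp X) = exp(ad X), by regrouping the double sum along i + j = k. The bound m is left free so
    that terms of low order can be peeled off. *)
Lemma expm_conj m X Y : (n <= m)%N -> above_diag 1 X -> above_diag 0 Y ->
  expm X *m Y *m expm (- X) = \sum_(k < m) ad_divpow k X Y.
Proof.
move=> nm hX hY.
have -> : expm X *m Y *m expm (- X) = \sum_(k < n) ad_divpow k X Y.
  rewrite /expm !mulmx_suml; under eq_bigr do rewrite mulmx_sumr.
  apply: (@sum_triangle _ _ (fun i j => divpow i X *m Y *m divpow j (- X))).
  move=> i j nij; apply: above_diag_eq0 nij _; apply: above_diagM.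
    by apply: above_diagMr => //; apply: above_diag_divpow.
  by apply: above_diag_divpow; apply: above_diagN.
rewrite -!(big_mkord xpredT (fun k => ad_divpow k X Y)).
rewrite [RHS](@big_cat_nat _ _ _ n) //= -[LHS]addr0; congr (_ + _).
rewrite big_nat big1 // => k /andP[nk _].
by apply: above_diag_eq0 nk _; apply: above_diag_ad_divpow.
Qed.

Lemma mulmx_expm_conj A B X : A *m B = 1%:M -> B *m A = 1%:M ->
  A *m expm X *m B = expm (A *m X *m B).
Proof.
move=> AB BA; have pw k : A *m X ^+ k *m B = (A *m X *m B) ^+ k.
  elim: k => [|k IH]; first by rewrite !mulmx_pow0 mulmx1.
  by rewrite !mulmx_powS -IH !mulmxA -(mulmxA _ B A) BA mulmx1.
rewrite /expm mulmx_sumr mulmx_suml; apply: eq_bigr => k _.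
by rewrite /divpow -scalemxAr -scalemxAl pw.
Qed.

End Filtration.

(** * Polynomial functions and dimension *)

Section ScalarForms.
Local Open Scope ring_scope.
Variables (K : numFieldType) (V : lmodType K) (f : V -> K).
Hypothesis f_lin : scalar f.

Lemma scalar_map0 : f 0 = 0.
Proof. by have := f_lin (-1) 0 0; rewrite scaler0 addr0 mulN1r addNr. Qed.

Lemma scalar_mapZ a x : f (a *: x) = a * f x.
Proof. by have := f_lin a x 0; rewrite !addr0 scalar_map0 addr0. Qed.

Lemma scalar_mapD x y : f (x + y) = f x + f y.
Proof. by have := f_lin 1 x y; rewrite scale1r mul1r. Qed.

Lemma scalar_mapN x : f (- x) = - f x.
Proof. by rewrite -scaleN1r scalar_mapZ mulN1r. Qed.

Lemma scalar_mapB x y : f (x - y) = f x - f y.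
Proof. by rewrite scalar_mapD scalar_mapN. Qed.

Lemma scalar_map_sum (I : Type) (r : seq I) (P : pred I) (F : I -> V) :
  f (\sum_(i <- r | P i) F i) = \sum_(i <- r | P i) f (F i).
Proof. by apply: (big_morph f) => [x y|]; rewrite ?scalar_mapD ?scalar_map0. Qed.

End ScalarForms.

(** * Algebras of scalar functions and matrices with entries in them *)

Section FunctionAlgebras.
Local Open Scope ring_scope.
Variables (K : numFieldType) (T : Type).

(** The closure lemmas are proved once for such a class, then applied both to polynomials in one
    variable and to polynomial functions on affine space. *)
Definition fun_subalg (P : (T -> K) -> Prop) : Prop :=
  [/\ forall c, P (fun=> c),
      forall f g, P f -> P g -> P (fun x => f x + g x) &
      forall f g, P f -> P g -> P (fun x => f x * g x)].

Variable P : (T -> K) -> Prop.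
Hypothesis algP : fun_subalg P.

Lemma fun_subalg_eq f g : f =1 g -> P f -> P g.
Proof. by move=> /funext ->. Qed.

Lemma fun_subalg_cst c : P (fun=> c).
Proof. by case: algP. Qed.

Lemma fun_subalgD f g : P f -> P g -> P (fun x => f x + g x).
Proof. by case: algP => _ + _; apply. Qed.

Lemma fun_subalgM f g : P f -> P g -> P (fun x => f x * g x).
Proof. by case: algP => _ _; apply. Qed.

Lemma fun_subalgN f : P f -> P (fun x => - f x).
Proof.
move=> Pf; apply: (@fun_subalg_eq (fun x => -1 * f x)) => [x|].
  by rewrite mulN1r.
by apply: fun_subalgM => //; apply: fun_subalg_cst.
Qed.

Lemma fun_subalg_sum (I : Type) (r : seq I) (Q : pred I) (F : I -> T -> K) :
  (forall i, Q i -> P (F i)) -> P (fun x => \sum_(i <- r | Q i) F i x).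
Proof.
move=> PF; elim: r => [|i r IH].
  by apply: fun_subalg_eq (fun_subalg_cst 0) => x; rewrite big_nil.
have [Qi|Qi] := boolP (Q i).
  apply: fun_subalg_eq (fun_subalgD (PF i Qi) IH) => x.
  by rewrite big_cons Qi.
by apply: fun_subalg_eq IH => x; rewrite big_cons (negbTE Qi).
Qed.

Lemma fun_subalg_prod (I : Type) (r : seq I) (F : I -> T -> K) :
  (forall i, P (F i)) -> P (fun x => \prod_(i <- r) F i x).
Proof.
move=> PF; elim: r => [|i r IH].
  by apply: fun_subalg_eq (fun_subalg_cst 1) => x; rewrite big_nil.
by apply: fun_subalg_eq (fun_subalgM (PF i) IH) => x; rewrite big_cons.
Qed.

Lemma fun_subalgX f k : P f -> P (fun x => f x ^+ k).
Proof.
move=> Pf; elim: k => [|k IH].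
  by apply: fun_subalg_eq (fun_subalg_cst 1) => x; rewrite expr0.
by apply: fun_subalg_eq (fun_subalgM Pf IH) => x; rewrite exprS.
Qed.

Lemma fun_subalg_eval m (F : T -> 'rV[K]_m) (p : mpoly m K) :
  (forall j, P (fun x => F x 0 j)) -> P (fun x => eval_at (F x) p).
Proof.
move=> PF; apply: (@fun_subalg_eq (fun x =>
  \sum_(e <- msupp p) mcoeff e p * \prod_i F x 0 i ^+ e i)) => [x|].
  by rewrite /eval_at mevalE.
apply: fun_subalg_sum => e _; apply: fun_subalgM; first exact: fun_subalg_cst.
by apply: fun_subalg_prod => i; apply: fun_subalgX.
Qed.

Definition mx_entries a b (F : T -> 'M[K]_(a, b)) : Prop :=
  forall i j, P (fun x => F x i j).

Lemma mx_entries_cst a b (A : 'M[K]_(a, b)) : mx_entries (fun=> A).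
Proof. by move=> i j; apply: fun_subalg_cst. Qed.

Lemma mx_entriesD a b (F G : T -> 'M[K]_(a, b)) :
  mx_entries F -> mx_entries G -> mx_entries (fun x => F x + G x).
Proof.
move=> PF PG i j; apply: fun_subalg_eq (fun_subalgD (PF i j) (PG i j)) => x.
by rewrite mxE.
Qed.

Lemma mx_entriesN a b (F : T -> 'M[K]_(a, b)) :
  mx_entries F -> mx_entries (fun x => - F x).
Proof.
move=> PF i j; apply: fun_subalg_eq (fun_subalgN (PF i j)) => x.
by rewrite mxE.
Qed.

Lemma mx_entriesZ a b (f : T -> K) (F : T -> 'M[K]_(a, b)) :
  P f -> mx_entries F -> mx_entries (fun x => f x *: F x).
Proof.
move=> Pf PF i j; apply: fun_subalg_eq (fun_subalgM Pf (PF i j)) => x.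
by rewrite mxE.
Qed.

Lemma mx_entriesM a b c (F : T -> 'M[K]_(a, b)) (G : T -> 'M[K]_(b, c)) :
  mx_entries F -> mx_entries G -> mx_entries (fun x => F x *m G x).
Proof.
move=> PF PG i j; apply: (@fun_subalg_eq (fun x => \sum_k F x i k * G x k j)).
  by move=> x; rewrite mxE.
by apply: fun_subalg_sum => k _; apply: fun_subalgM.
Qed.

Lemma mx_entries_sum a b (I : Type) (r : seq I) (Q : pred I)
    (F : I -> T -> 'M[K]_(a, b)) :
  (forall i, Q i -> mx_entries (F i)) ->
  mx_entries (fun x => \sum_(i <- r | Q i) F i x).
Proof.
move=> PF i j; apply: (@fun_subalg_eq (fun x => \sum_(k <- r | Q k) F k x i j)).
  by move=> x; rewrite summxE.
by apply: fun_subalg_sum => k Qk; apply: PF.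
Qed.

Lemma mx_entries_scalar a b (f : 'M[K]_(a, b) -> K) F :
  scalar f -> mx_entries F -> P (fun x => f (F x)).
Proof.
move=> f_lin PF; apply: (@fun_subalg_eq (fun x =>
  \sum_i \sum_j F x i j * f (delta_mx i j))) => [x|].
  rewrite [in RHS](matrix_sum_delta (F x)) scalar_map_sum //; apply: eq_bigr => i _.
  by rewrite scalar_map_sum //; apply: eq_bigr => j _; rewrite scalar_mapZ.
apply: fun_subalg_sum => i _; apply: fun_subalg_sum => j _.
by apply: fun_subalgM => //; apply: fun_subalg_cst.
Qed.

Lemma mx_entries_linear_mx a b c d (f : {linear 'M[K]_(a, b) -> 'M[K]_(c, d)}) F :
  mx_entries F -> mx_entries (fun x => f (F x)).
Proof.
move=> PF k l; apply: (@fun_subalg_eq (fun x =>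
  \sum_i \sum_j F x i j * f (delta_mx i j) k l)) => [x|].
  rewrite [in RHS](matrix_sum_delta (F x)) linear_sum summxE.
  apply: eq_bigr => i _; rewrite linear_sum summxE; apply: eq_bigr => j _.
  by rewrite linearZ mxE.
apply: fun_subalg_sum => i _; apply: fun_subalg_sum => j _.
by apply: fun_subalgM => //; apply: fun_subalg_cst.
Qed.

Lemma mx_entries_row_mx a b c (F : T -> 'M[K]_(a, b)) (G : T -> 'M[K]_(a, c)) :
  mx_entries F -> mx_entries G -> mx_entries (fun x => row_mx (F x) (G x)).
Proof.
move=> PF PG i j.
case: (split_ordP j) => k ->.
  by apply: fun_subalg_eq (PF i k) => x; rewrite row_mxEl.
by apply: fun_subalg_eq (PG i k) => x; rewrite row_mxEr.
Qed.

Lemma mx_entriesX n (F : T -> 'M[K]_n) k :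
  mx_entries F -> mx_entries (fun x => F x ^+ k).
Proof.
move=> PF; elim: k => [|k IH]; first exact: (mx_entries_cst 1%:M).
move=> i j; apply: fun_subalg_eq (mx_entriesM PF IH i j) => x.
by rewrite mulmx_powS.
Qed.

Lemma mx_entries_divpow n (F : T -> 'M[K]_n) k :
  mx_entries F -> mx_entries (fun x => divpow k (F x)).
Proof.
by move=> PF; apply: mx_entriesZ; [exact: fun_subalg_cst | exact: mx_entriesX].
Qed.

Lemma mx_entries_expm n (F : T -> 'M[K]_n) :
  mx_entries F -> mx_entries (fun x => expm (F x)).
Proof. by move=> PF; apply: mx_entries_sum => k _; apply: mx_entries_divpow. Qed.

Lemma mx_entries_logm n (F : T -> 'M[K]_n) :
  mx_entries F -> mx_entries (fun x => logm (F x)).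
Proof.
move=> PF.
have iter_entries m : mx_entries (fun x =>
    iter m (fun X : 'M[K]_n => X + (F x - expm X)) 0).
  elim: m => [|m IH] /=; first exact: mx_entries_cst.
  apply: mx_entriesD => //; apply: mx_entriesD => //.
  by apply: mx_entriesN; apply: mx_entries_expm.
exact: iter_entries.
Qed.

End FunctionAlgebras.

(** * Polynomial functions of one variable *)

Section UnivariatePolynomialFunctions.
Local Open Scope ring_scope.
Variable K : numFieldType.

Definition upolyfun (f : K -> K) : Prop := exists q : {poly K}, forall t, f t = q.[t].

Lemma upolyfun_subalg : fun_subalg upolyfun.
Proof.
split=> [c|f g [p fp] [q gq]|f g [p fp] [q gq]].
- by exists c%:P => t; rewrite hornerC.
- by exists (p + q) => t; rewrite hornerD fp gq.
by exists (p * q) => t; rewrite hornerM fp gq.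
Qed.

Lemma upolyfun_id : upolyfun id.
Proof. by exists 'X => t; rewrite hornerX. Qed.

(** In characteristic zero the points 1, 2, 3, ... are more roots than the degree allows. They
    correspond to the positive powers of a group element, and they avoid t = 0. *)
Lemma poly_nat_eq0 (q : {poly K}) : (forall m : nat, q.[m.+1%:R] = 0) -> q = 0.
Proof.
move=> q0; apply/eqP; apply: contraT => qn0.
pose s := [seq m.+1%:R : K | m <- iota 0 (size q)].
have : (size s < size q)%N.
  apply: max_poly_roots => //.
    by apply/allP => _ /mapP[m _ ->]; apply/eqP.
  rewrite map_inj_uniq ?iota_uniq // => a b /eqP.
  by rewrite eqr_nat => /eqP[].
by rewrite size_map size_iota ltnn.
Qed.

Lemma upolyfun_eq0 f : upolyfun f -> (forall m : nat, f m.+1%:R = 0) ->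
  forall t, f t = 0.
Proof.
move=> [q fq] f0 t; rewrite fq (@poly_nat_eq0 q) ?horner0 // => m.
by rewrite -fq.
Qed.

Lemma upolyfun_eq0_off0 f : upolyfun f -> (forall t, t != 0 -> f t = 0) ->
  forall t, f t = 0.
Proof.
by move=> pf f0; apply: upolyfun_eq0 => // m; apply: f0; rewrite pnatr_eq0.
Qed.

Lemma upolyfun_integral f g : upolyfun f -> upolyfun g ->
  (forall t, f t * g t = 0) -> (forall t, f t = 0) \/ (forall t, g t = 0).
Proof.
move=> [p fp] [q gq] fg0.
have /eqP : p * q = 0 by apply: poly_nat_eq0 => m; rewrite hornerM -fp -gq.
rewrite mulf_eq0 => /orP[] /eqP e; [left|right] => t.
  by rewrite fp e horner0.
by rewrite gq e horner0.
Qed.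

Lemma upolyfun_div f : upolyfun f -> f 0 = 0 ->
  exists2 g, upolyfun g & forall t, f t = t * g t.
Proof.
move=> [q fq] f0; have : root q 0 by apply/eqP; rewrite -fq.
case/factor_theorem => r qr; exists (fun t => r.[t]); first by exists r.
by move=> t; rewrite fq qr subr0 hornerM hornerX mulrC.
Qed.

Lemma upolyfun_coef m (c : nat -> K) : (forall t, \sum_(k < m) t ^+ k * c k = 0) ->
  forall k, (k < m)%N -> c k = 0.
Proof.
move=> h k km; have q0 : \poly_(i < m) c i = 0.
  apply: poly_nat_eq0 => t; rewrite horner_poly -[RHS](h t.+1%:R).
  by apply: eq_bigr => i _; rewrite mulrC.
by have := congr1 (fun q : {poly K} => q`_k) q0; rewrite coef_poly km coef0.
Qed.

(** Serves to extend log(F t) / t polynomially to t = 0. *)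
Lemma mx_upoly_div a b (F : K -> 'M[K]_(a, b)) :
  mx_entries upolyfun F -> F 0 = 0 ->
  exists2 G, mx_entries upolyfun G & forall t, F t = t *: G t.
Proof.
move=> PF F0.
have /choice[g gP] : forall ij : 'I_a * 'I_b, exists g : K -> K,
    upolyfun g /\ forall t, F t ij.1 ij.2 = t * g t.
  move=> [i j]; have [|g pg gE] := upolyfun_div (PF i j); first by rewrite F0 mxE.
  by exists g.
exists (fun t => \matrix_(i, j) g (i, j) t).
  move=> i j; apply: fun_subalg_eq (gP (i, j)).1 => t; by rewrite mxE.
by move=> t; apply/matrixP => i j; rewrite !mxE (gP (i, j)).2.
Qed.

End UnivariatePolynomialFunctions.

(** * Polynomial maps and irreducible closed sets *)

Section PolynomialFunctions.
Local Open Scope classical_set_scope.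
Local Open Scope ring_scope.
Variables (K : numFieldType).

Definition polyfun m (f : 'rV[K]_m -> K) : Prop :=
  exists p : mpoly m K, forall x, f x = eval_at x p.

Lemma polyfun_subalg m : fun_subalg (@polyfun m).
Proof.
split=> [c|f g [p fp] [q gq]|f g [p fp] [q gq]].
- by exists (mpolyC m c) => x; rewrite /eval_at mevalC.
- by exists (p + q) => x; rewrite fp gq /eval_at mevalD.
by exists (p * q) => x; rewrite fp gq /eval_at mevalM.
Qed.

Lemma polyfun_coord m (j : 'I_m) : polyfun (fun x => x 0 j).
Proof. by exists (mpolyX K (mnm1 j)) => x; rewrite /eval_at mevalXU. Qed.

Lemma polyfun_id m : mx_entries (@polyfun m) id.
Proof. by move=> i j; rewrite (ord1 i); apply: polyfun_coord. Qed.

Definition polymap m k (f : 'rV[K]_m -> 'rV[K]_k) := mx_entries (@polyfun m) f.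

Lemma polymap_variety_morphism m k (X : set 'rV[K]_m) (Y : set 'rV[K]_k) f :
  polymap f -> (forall x, X x -> Y (f x)) -> variety_morphism X Y f.
Proof.
move=> pf XY; split=> //.
have /choice[p pP] : forall j, exists p : mpoly m K, forall x, f x 0 j = eval_at x p.
  by move=> j; apply: pf.
by exists p => x _ j.
Qed.

Lemma polymap_comp m k l (f : 'rV[K]_k -> 'rV[K]_l) (g : 'rV[K]_m -> 'rV[K]_k) :
  polymap f -> polymap g -> polymap (fun x => f (g x)).
Proof.
move=> pf pg i j; have [p fp] := pf i j.
apply: fun_subalg_eq (fun_subalg_eval (polyfun_subalg m) p (pg 0)) => x.
by rewrite fp.
Qed.

Lemma polyfun_zero_set m (f : 'rV[K]_m -> K) : polyfun f ->
  algebraic_set [set x | f x = 0].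
Proof.
move=> [p fp]; exists [set p]; apply/seteqP; split=> x /=.
  by move=> fx q ->; rewrite -fp.
by move=> /(_ p erefl); rewrite fp.
Qed.

Lemma polymap_fixed_points m (f : 'rV[K]_m -> 'rV[K]_m) : polymap f ->
  algebraic_set [set x | f x = x].
Proof.
move=> pf.
have /choice[p pP] : forall j, exists p : mpoly m K,
    forall x, f x 0 j - x 0 j = eval_at x p.
  move=> j; change (polyfun (fun x => f x 0 j - x 0 j)).
  apply: fun_subalgD; [exact: polyfun_subalg|exact: pf|].
  by apply: fun_subalgN; [exact: polyfun_subalg|exact: polyfun_coord].
exists (range p); apply/seteqP; split=> x /=.
  by move=> fx _ [j _ <-]; rewrite -pP fx subrr.
move=> h; apply/rowP => j; apply/eqP; rewrite -subr_eq0 pP; apply/eqP.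
by apply: h; exists j.
Qed.

(** The zero sets of f and g are closed and cover Z; in other words, the vanishing ideal of Z is
    prime. *)
Lemma irreducible_setM m (Z : set 'rV[K]_m) f g : irreducible_set Z ->
  polyfun f -> polyfun g -> (forall x, Z x -> f x * g x = 0) ->
  (forall x, Z x -> f x = 0) \/ (forall x, Z x -> g x = 0).
Proof.
move=> [_ irr] pf pg fg.
have [] := irr _ _ (polyfun_zero_set pf) (polyfun_zero_set pg); last 2 first.
- by left.
- by right.
by move=> x /fg /eqP; rewrite mulf_eq0 => /orP[] /eqP; [left|right].
Qed.

(** Join a point where an equation p of X fails to one where an equation q of Y fails. On this line,
    which stays in A, the product of p and q vanishes, so one factor vanishes identically, a
    contradiction. *)
Lemma irreducible_polymap_image m k (phi : 'rV[K]_m -> 'rV[K]_k)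
    (A : set 'rV[K]_m) : polymap phi -> A !=set0 ->
  (forall x y t, A x -> A y -> A (x + t *: (y - x))) ->
  irreducible_set (phi @` A).
Proof.
move=> pphi [a0 Aa0] Aline; split; first by exists (phi a0), a0.
move=> X Y [I ->] [J ->] ZXY; apply: contrapT => /not_orP[ZX ZY].
have [x [Ax [p [Ip px]]]] : exists x, A x /\ exists p, I p /\ eval_at (phi x) p <> 0.
  apply: contrapT => h; apply: ZX => _ [x Ax <-] p Ip.
  by apply: contrapT => px; apply: h; exists x; split=> //; exists p.
have [y [Ay [q [Jq qy]]]] : exists y, A y /\ exists q, J q /\ eval_at (phi y) q <> 0.
  apply: contrapT => h; apply: ZY => _ [y Ay <-] q Jq.
  by apply: contrapT => qy; apply: h; exists y; split=> //; exists q.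
pose l t := x + t *: (y - x).
have ul (r : mpoly k K) : upolyfun (fun t => eval_at (phi (l t)) r).
  apply: fun_subalg_eval => [|j]; first exact: upolyfun_subalg.
  have [s sP] := pphi 0 j.
  apply: (@fun_subalg_eq _ _ _ (fun t => eval_at (l t) s)) => [t|].
    by rewrite sP.
  apply: fun_subalg_eval => [|i]; first exact: upolyfun_subalg.
  apply: (@fun_subalg_eq _ _ _ (fun t => x 0 i + t * (y - x) 0 i)) => [t|].
    by rewrite !mxE.
  apply: fun_subalgD; [exact: upolyfun_subalg| |].
    by apply: fun_subalg_cst; exact: upolyfun_subalg.
  apply: fun_subalgM; [exact: upolyfun_subalg|exact: upolyfun_id|].
  by apply: fun_subalg_cst; exact: upolyfun_subalg.
have [t|h|h] := upolyfun_integral (ul p) (ul q).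
- have [|/(_ p Ip) ->|/(_ q Jq) ->] := ZXY (phi (l t)).
  + by exists (l t) => //; apply: Aline.
  + by rewrite mul0r.
  + by rewrite mulr0.
- by apply: px; have := h 0; rewrite /l scale0r addr0.
by apply: qy; have := h 1; rewrite /l scale1r addrC subrK.
Qed.

End PolynomialFunctions.

(** * Polynomial functions of bounded degree *)

Section BoundedDegree.
Local Open Scope ring_scope.
Variable K : numFieldType.

Definition polyfun_deg m (d : nat) (f : 'rV[K]_m -> K) : Prop :=
  exists2 p : mpoly m K, forall e, e \in msupp p -> (mdeg e <= d)%N &
    forall x, f x = eval_at x p.

Lemma polyfun_deg_eq m d (f g : 'rV[K]_m -> K) :
  f =1 g -> polyfun_deg d f -> polyfun_deg d g.
Proof. by move=> /funext ->. Qed.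

Lemma polyfun_degP m (f : 'rV[K]_m -> K) :
  polyfun f -> exists d, polyfun_deg d f.
Proof.
move=> [p fp]; exists (\max_(e <- msupp p) mdeg e)%N; exists p => // e ep.
exact: (@leq_bigmax_seq _ _ xpredT (fun e => mdeg e)).
Qed.

Lemma polyfun_degW m d d' (f : 'rV[K]_m -> K) :
  (d <= d')%N -> polyfun_deg d f -> polyfun_deg d' f.
Proof. by move=> dd' [p dp fp]; exists p => // e /dp /leq_trans; apply. Qed.

Lemma polyfun_deg_cst m c : polyfun_deg 0 (fun=> c : K) (m := m).
Proof.
exists (mpolyC m c) => [e|x]; last by rewrite /eval_at mevalC.
rewrite msuppC; case: eqP => // _; rewrite inE => /eqP ->.
by rewrite mdeg0.
Qed.

Lemma polyfun_degD m d (f g : 'rV[K]_m -> K) :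
  polyfun_deg d f -> polyfun_deg d g -> polyfun_deg d (fun x => f x + g x).
Proof.
move=> [p dp fp] [q dq gq]; exists (p + q) => [e|x].
  by move=> /msuppD_le; rewrite mem_cat => /orP[/dp|/dq].
by rewrite fp gq /eval_at mevalD.
Qed.

Lemma polyfun_degM m d d' (f g : 'rV[K]_m -> K) :
  polyfun_deg d f -> polyfun_deg d' g ->
  polyfun_deg (d + d') (fun x => f x * g x).
Proof.
move=> [p dp fp] [q dq gq]; exists (p * q) => [e|x].
  move=> /msuppM_le /allpairsP[[a b] /= [/dp da /dq db ->]].
  by rewrite mdegD leq_add.
by rewrite fp gq /eval_at mevalM.
Qed.

Lemma polyfun_degX m d k (f : 'rV[K]_m -> K) :
  polyfun_deg d f -> polyfun_deg (k * d) (fun x => f x ^+ k).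
Proof.
move=> df; elim: k => [|k IH].
  by apply: polyfun_deg_eq (polyfun_deg_cst m 1) => x; rewrite expr0.
rewrite mulSn; apply: polyfun_deg_eq (polyfun_degM df IH) => x.
by rewrite exprS.
Qed.

Lemma polyfun_deg_sum m d (I : eqType) (r : seq I) (F : I -> 'rV[K]_m -> K) :
  (forall i, i \in r -> polyfun_deg d (F i)) ->
  polyfun_deg d (fun x => \sum_(i <- r) F i x).
Proof.
elim: r => [|i r IH] dF.
  apply: polyfun_degW (leq0n d) _.
  by apply: polyfun_deg_eq (polyfun_deg_cst m 0) => x; rewrite big_nil.
have dFi := dF i (mem_head i r).
have dFr : polyfun_deg d (fun x => \sum_(i <- r) F i x).
  by apply: IH => j jr; apply: dF; rewrite inE jr orbT.
by apply: polyfun_deg_eq (polyfun_degD dFi dFr) => x; rewrite big_cons.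
Qed.

Lemma polyfun_deg_prod m (I : Type) (r : seq I) (d : I -> nat)
    (F : I -> 'rV[K]_m -> K) :
  (forall i, polyfun_deg (d i) (F i)) ->
  polyfun_deg (\sum_(i <- r) d i)%N (fun x => \prod_(i <- r) F i x).
Proof.
move=> dF; elim: r => [|i r IH].
  rewrite big_nil; apply: polyfun_deg_eq (polyfun_deg_cst m 1) => x.
  by rewrite big_nil.
rewrite big_cons; apply: polyfun_deg_eq (polyfun_degM (dF i) IH) => x.
by rewrite big_cons.
Qed.

Lemma polyfun_deg_comp m k d e (f : 'rV[K]_k -> K) (phi : 'rV[K]_m -> 'rV[K]_k) :
  polyfun_deg d f -> (forall j, polyfun_deg e (fun x => phi x 0 j)) ->
  polyfun_deg (d * e) (fun x => f (phi x)).
Proof.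
move=> [p dp fp] dphi.
apply: (@polyfun_deg_eq _ _ (fun x =>
  \sum_(a <- msupp p) mcoeff a p * \prod_i phi x 0 i ^+ a i)) => [x|].
  by rewrite fp /eval_at mevalE.
apply: polyfun_deg_sum => a /dp da.
apply: (@polyfun_degW _ (0 + \sum_i a i * e)%N).
  by rewrite add0n -big_distrl -mdegE leq_mul2r da orbT.
apply: polyfun_degM; first exact: polyfun_deg_cst.
by apply: polyfun_deg_prod => i; apply: polyfun_degX.
Qed.

Definition lin_indep_on m (I : finType) (Z : 'rV[K]_m -> Prop)
    (F : I -> 'rV[K]_m -> K) : Prop :=
  forall c : I -> K, (forall x, Z x -> \sum_i c i * F i x = 0) ->
    forall i, c i = 0.

(* A nontrivial kernel vector of the coefficient matrix gives a linear
   relation as soon as there are more functions than monomials. *)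
Lemma lin_indep_card m d (I : finType) (F : I -> 'rV[K]_m -> K) :
  (forall i, polyfun_deg d (F i)) -> lin_indep_on (fun=> True) F ->
  (#|I| <= d.+1 ^ m)%N.
Proof.
move=> dF indF; rewrite leqNgt; apply/negP => ltI.
have /choice[p pP] : forall i, exists p : mpoly m K,
    (forall e, e \in msupp p -> (mdeg e <= d)%N) /\ forall x, F i x = eval_at x p.
  by move=> i; have [p ? ?] := dF i; exists p.
(* Bounding each exponent by d, instead of the total degree, overcounts the monomials but makes
   their number (d + 1)^m at sight. *)
pose J := {ffun 'I_m -> 'I_d.+1}.
pose mon (a : J) : multinom m := Multinom [tuple (a i : nat) | i < m].
have cardJ : #|J| = (d.+1 ^ m)%N by rewrite card_ffun !card_ord.
pose A : 'M[K]_(#|I|, #|J|) :=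
  \matrix_(i, j) mcoeff (mon (enum_val j)) (p (enum_val i)).
have : \rank (kermx A) != 0%N.
  by rewrite mxrank_ker subn_eq0 -ltnNge (leq_ltn_trans (rank_leq_col A)) // cardJ.
rewrite mxrank_eq0 => /eqP kerA.
have [i /eqP ri] : exists i, row i (kermx A) != 0.
  apply: contrapT => h; apply: kerA; apply/row_matrixP => i; rewrite row0.
  by apply/eqP; apply: contrapT => hi; apply: h; exists i; apply/negP.
have : row i (kermx A) *m A = 0 by apply/sub_kermxP; apply: row_sub.
move: (row i (kermx A)) ri => c ri cA.
apply: ri; apply/rowP => k; rewrite [RHS]mxE.
suff /(_ (enum_val k)) : forall j, c 0 (enum_rank j) = 0 by rewrite enum_valK.
apply: indF => x _.
(* All coefficients of this combination vanish: above degree d because each [p j] has none there,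
   otherwise by the kernel equation. *)
have q0 : \sum_j c 0 (enum_rank j) *: p j = 0.
  apply/mpolyP => e; rewrite mcoeff0 raddf_sum /=.
  have [ed|ed] := leqP (mdeg e) d; last first.
    apply: big1 => j _; rewrite mcoeffZ (_ : mcoeff e (p j) = 0) ?mulr0 //.
    apply/eqP; rewrite mcoeff_eq0; apply: contraL ed => /(pP j).1.
    by rewrite -leqNgt.
  have ei (l : 'I_m) : (e l < d.+1)%N.
    rewrite ltnS; apply: leq_trans ed; rewrite mdegE (bigD1 l) //=.
    exact: leq_addr.
  pose a : J := [ffun l => Ordinal (ei l)].
  have -> : e = mon a.
    by apply/mnmP => l; rewrite multinomE tnth_mktuple ffunE.
  have := congr1 (fun M : 'rV_ _ => M 0 (enum_rank a)) cA.
  rewrite !mxE => {2}<-; rewrite (reindex _ (onW_bij _ (@enum_val_bij I))) /=.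
  by apply: eq_bigr => l _; rewrite mxE enum_rankK enum_valK mcoeffZ.
have := congr1 (eval_at x) q0.
rewrite /eval_at raddf_sum meval0 => {2}<-.
by apply: eq_bigr => j _ /=; rewrite mevalZ (pP j).2.
Qed.

End BoundedDegree.

(** * Krull dimension by counting polynomial functions *)

Section KrullDimension.
Local Open Scope classical_set_scope.
Local Open Scope ring_scope.
Variable K : numFieldType.

(* Growth of the Hilbert function of Z at least of order k, expressed without
   transcendence bases. *)
Definition hilbert_growth m (k : nat) (Z : set 'rV[K]_m) : Prop :=
  exists D : nat, forall N : nat, exists (I : finType) (F : I -> 'rV[K]_m -> K),
    [/\ #|I| = (N ^ k)%N, forall i, polyfun_deg (D * N) (F i) & lin_indep_on Z F].

Lemma hilbert_growth0 m (Z : set 'rV[K]_m) : Z !=set0 -> hilbert_growth 0 Z.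
Proof.
move=> [x Zx]; exists 0%N => N; exists unit, (fun _ _ => 1); split=> //.
- by rewrite card_unit.
- by move=> _; apply: polyfun_deg_cst.
move=> c /(_ x Zx); rewrite (big_pred1 tt) => [|[]//]; rewrite mulr1.
by move=> ctt [].
Qed.

(* Multiply a family on Z by the powers of a function f vanishing on Z: the
   lowest power of f in a relation on Z' can be cancelled since Z' is
   irreducible, and then its coefficients vanish by restricting to Z. *)
Lemma hilbert_growthS m k (Z Z' : set 'rV[K]_m) :
  algebraic_set Z -> irreducible_set Z' -> Z `<` Z' ->
  hilbert_growth k Z -> hilbert_growth k.+1 Z'.
Proof.
move=> [I ZI] irrZ' [ZZ' nZZ'] [D growth].
have [f [pf fZ [x0 Z'x0 fx0]]] : exists f, [/\ polyfun f,
    (forall x, Z x -> f x = 0) & exists2 x, Z' x & f x <> 0].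
  apply: contrapT => h; apply: nZZ' => x Z'x; rewrite ZI => p Ip.
  apply: contrapT => px; apply: h; exists (fun x => eval_at x p); split.
  - by exists p.
  - by move=> y; rewrite ZI; apply.
  by exists x.
have [e df] := polyfun_degP pf.
exists (D + e)%N => N; have [J [F [cardJ dF indF]]] := growth N.
exists (J * 'I_N)%type, (fun (ji : J * 'I_N) x => F ji.1 x * f x ^+ ji.2); split.
- by rewrite card_prod cardJ card_ord expnSr.
- move=> [j i] /=; rewrite mulnDl; apply: polyfun_degM => //.
  apply: polyfun_degW (polyfun_degX i df).
  by rewrite mulnC leq_mul2l (ltnW (ltn_ord i)) orbT.
move=> c c0.
suff coef0 l : forall i : 'I_N, (i < l)%N -> forall j, c (j, i) = 0.
  by move=> [j i]; apply: (coef0 i.+1).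
elim: l => [//|l IH] i; rewrite ltnS leq_eqVlt => /orP[/eqP il|]; last exact: IH.
(* The relation divided by f^l. Coefficients below l vanish by induction; the test removes them
   because the truncated exponent [ji.2 - l] would be 0 there. *)
pose g x := \sum_(ji : J * 'I_N) (if (l <= ji.2)%N then c (ji.1, ji.2) else 0) *
  (F ji.1 x * f x ^+ (ji.2 - l)).
have pF j : polyfun (F j) by have [p _ pP] := dF j; exists p.
have pg : polyfun g.
  apply: fun_subalg_sum => [|[j i'] _]; first exact: polyfun_subalg.
  apply: fun_subalgM; first exact: polyfun_subalg.
    by apply: fun_subalg_cst; exact: polyfun_subalg.
  apply: fun_subalgM; [exact: polyfun_subalg|exact: pF|].
  by apply: fun_subalgX => //; exact: polyfun_subalg.
have fg x : Z' x -> f x ^+ l * g x = 0.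
  move=> Z'x; rewrite -[RHS](c0 x Z'x) /g mulr_sumr.
  apply: eq_bigr => -[j i'] _ /=.
  case: leqP => [li|li]; last by rewrite (IH i') // !mul0r mulr0.
  by rewrite mulrCA (mulrCA (f x ^+ l)) -exprD subnKC.
have pfl : polyfun (fun x => f x ^+ l).
  by apply: fun_subalgX => //; exact: polyfun_subalg.
have [/(_ x0 Z'x0)/eqP|g0] := irreducible_setM irrZ' pfl pg fg.
  by rewrite expf_eq0 => /andP[_ /eqP /fx0].
move=> j; apply: (indF (fun j => c (j, i))) => x Zx.
rewrite -[RHS](g0 x (ZZ' x Zx)) /g.
rewrite -(pair_bigA _ (fun (j : J) (i : 'I_N) => (if (l <= i)%N then c (j, i) else 0) *
  (F j x * f x ^+ (i - l)))) /=.
(* On Z, where f vanishes, only the power 0 of f, that is the index l, survives. *)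
apply: eq_bigr => j' _; rewrite (bigD1 i) //= -il leqnn subnn expr0 mulr1.
rewrite big1 ?addr0 // => i' ii'.
case: leqP => [li|li]; last by rewrite mul0r.
rewrite fZ // expr0n subn_eq0 leqNgt ltn_neqAle li andbT.
by rewrite eq_sym (inj_eq val_inj) ii' /= !mulr0.
Qed.

Lemma chain_hilbert_growth m (X : set 'rV[K]_m) k :
  has_irreducible_chain X k -> exists2 Z, Z `<=` X & hilbert_growth k Z.
Proof.
move=> [Z [Zirr Zlt]]; exists (Z k); first by have [] := Zirr k (leqnn k).
have : forall i, (i <= k)%N -> hilbert_growth i (Z i); last exact.
elim=> [|i IH] ik.
  by apply: hilbert_growth0; have [_ []] := Zirr 0%N ik.
have [Zi _ _] := Zirr i (ltnW ik); have [_ irr _] := Zirr i.+1 ik.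
by apply: hilbert_growthS (Zlt i ik) (IH (ltnW ik)).
Qed.

(** Pulling back along phi multiplies degrees by a constant and keeps independence, so N^l
    independent functions of degree O(N) live on affine m-space, which has room for only O(N^m). *)
Lemma hilbert_growth_le m k l (phi : 'rV[K]_m -> 'rV[K]_k) (Z : set 'rV[K]_k) :
  polymap phi -> Z `<=` range phi -> hilbert_growth l Z -> (l <= m)%N.
Proof.
move=> pphi Zphi [D growth].
have /choice[d dphi] : forall j, exists d, polyfun_deg d (fun x => phi x 0 j).
  by move=> j; apply: polyfun_degP; apply: pphi.
pose e := (\max_j d j)%N.
have {}dphi j : polyfun_deg e (fun x => phi x 0 j).
  by apply: polyfun_degW (dphi j); apply: leq_bigmax.
(* B * N bounds D * N * e + 1, and N exceeds B^m; hence (B * N)^m < N^(m+1), which contradicts the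
   count if l > m. *)
pose B := (D * e).+1; pose N := (B ^ m).+1.
have [I [F [cardI dF indF]]] := growth N.
have : (#|I| <= (D * N * e).+1 ^ m)%N.
  apply: (@lin_indep_card K m _ _ (fun i x => F i (phi x))) => [i|c c0].
    exact: polyfun_deg_comp.
  apply: indF => x /Zphi[y _ <-]; exact: c0.
rewrite cardI leqNgt => /negP NlD; rewrite leqNgt; apply/negP => ml; apply: NlD.
apply: (@leq_trans (N ^ m.+1)); last by rewrite leq_pexp2l.
rewrite expnS; apply: (@leq_ltn_trans ((B * N) ^ m)).
  have [->|m0] := posnP m; first by rewrite !expn0.
  by rewrite leq_exp2r // mulnAC /B mulSn addnC -addn1 leq_add.
by rewrite expnMn ltn_pmul2r ?expn_gt0 // /N ltnS.
Qed.

Definition coord_trunc m i (y : 'rV[K]_m) : 'rV[K]_m :=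
  \row_j (if (j < i)%N then y 0 j else 0).

Lemma coord_trunc_polymap m i : polymap (@coord_trunc m i).
Proof.
move=> a j; apply: (@fun_subalg_eq _ _ _ (fun y : 'rV[K]_m =>
  if (j < i)%N then y 0 j else 0)) => [y|]; first by rewrite mxE.
case: (j < i)%N; first exact: polyfun_coord.
by apply: fun_subalg_cst; exact: polyfun_subalg.
Qed.

Section Parametrized.
Variables (m k : nat) (phi : 'rV[K]_m -> 'rV[K]_k) (psi : 'rV[K]_k -> 'rV[K]_m).
Hypotheses (pphi : polymap phi) (ppsi : polymap psi) (phiK : cancel phi psi).

(** The range is the fixed locus of the polynomial map phi o psi. *)
Lemma range_algebraic_set : algebraic_set (range phi).
Proof.
have -> : range phi = [set x | phi (psi x) = x].
  apply/seteqP; split=> x /=; first by move=> [y _ <-]; rewrite phiK.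
  by move=> <-; exists (psi x).
by apply: polymap_fixed_points; apply: polymap_comp.
Qed.

Lemma range_isomorphic : isomorphic (range phi) [set: 'rV[K]_m].
Proof.
exists psi; split; first exact: polymap_variety_morphism.
exists phi; split=> //.
  by apply: polymap_variety_morphism => // y _; exists y.
by move=> _ [y _ <-]; rewrite phiK.
Qed.

(** The chain is the image of the standard coordinate flag: each member is closed as the fixed locus
    of phi o [coord_trunc i] o psi, and irreducible as the image of a linear space. *)
Lemma range_has_chain : has_irreducible_chain (range phi) m.
Proof.
exists (fun i => phi @` [set y | coord_trunc i y = y]); split=> i im.
  split.
  - have -> : phi @` [set y | coord_trunc i y = y] =
        [set x | phi (coord_trunc i (psi x)) = x].
      apply/seteqP; split=> x /=; first by move=> [y yi <-]; rewrite phiK yi.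
      move=> <-; exists (coord_trunc i (psi x)) => //=.
      by apply/rowP => j; rewrite !mxE; case: (j < i)%N.
    apply: polymap_fixed_points; apply: polymap_comp => //.
    by apply: polymap_comp => //; apply: coord_trunc_polymap.
  - apply: irreducible_polymap_image => //.
      by exists 0 => /=; apply/rowP => j; rewrite !mxE if_same.
    move=> x y t /= <- <-; apply/rowP => j; rewrite !mxE.
    by case: (j < i)%N => //; rewrite subrr mulr0 addr0.
  by move=> _ [y _ <-]; exists y.
split.
  move=> _ [y <- <-]; exists (coord_trunc i y) => //=.
  apply/rowP => j; rewrite !mxE; case: ifP => // /negbT; rewrite -leqNgt.
  by move=> ij; rewrite ltnNge (ltnW ij).
pose y : 'rV[K]_m := delta_mx 0 (Ordinal im).
have : (phi @` [set y | coord_trunc i.+1 y = y]) (phi y).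
  exists y => //=; apply/rowP => j; rewrite !mxE eqxx /=.
  by case: eqP => [->|_]; rewrite ?ltnSn // if_same.
move=> /[swap] /[apply] -[z zi /(congr1 psi)]; rewrite !phiK => zy.
move: zi; rewrite zy /= => /rowP /(_ (Ordinal im)).
by rewrite !mxE !eqxx ltnn => /esym/eqP; rewrite oner_eq0.
Qed.

Lemma range_dim d : has_dim (range phi) d -> d = m.
Proof.
move=> [chain max]; apply/eqP; rewrite eqn_leq (max _ range_has_chain) andbT.
have [Z Zphi growth] := chain_hilbert_growth chain.
exact: hilbert_growth_le pphi Zphi growth.
Qed.

End Parametrized.
End KrullDimension.

(** * Lie algebras of unipotent groups *)

Section LinearClosedSets.
Local Open Scope ring_scope.
Variables (K : numFieldType) (V : vectType K).

Definition linear_closed (A : V -> Prop) : Prop :=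
  A 0 /\ forall a x y, A x -> A y -> A (a *: x + y).

Lemma linear_closedZ A a x : linear_closed A -> A x -> A (a *: x).
Proof. by move=> [A0 Al] Ax; rewrite -[_ *: _]addr0; apply: Al. Qed.

Lemma linear_closedD A x y : linear_closed A -> A x -> A y -> A (x + y).
Proof. by move=> [A0 Al] Ax Ay; rewrite -[x]scale1r; apply: Al. Qed.

(** A subspace of maximal dimension inside A is all of A, since an element of A outside it could be
    adjoined. *)
Lemma linear_closed_vspace A : linear_closed A ->
  exists U : {vspace V}, forall x, x \in U <-> A x.
Proof.
move=> Al.
pose sub (U : {vspace V}) := forall x, x \in U -> A x.
pose D d := `[< exists U, sub U /\ \dim U = d >].
have exD : exists d, D d.
  exists 0%N; apply/asboolP; exists 0%VS; split; last by rewrite dimv0.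
  by move=> x; rewrite memv0 => /eqP ->; case: Al.
have ubD d : D d -> (d <= \dim {: V})%N.
  by move=> /asboolP[U [_ <-]]; apply: dimvS; apply: subvf.
have [d /asboolP[U [UA dU]] dmax] := ex_maxnP exD ubD.
exists U => x; split=> [/UA//|Ax]; apply: contrapT => /negP xU.
have dimUx : (\dim (U + <[x]>) <= \dim U)%N.
  rewrite dU; apply: dmax; apply/asboolP; exists (U + <[x]>)%VS; split=> // y.
  move=> /memv_addP[u uU [w /vlineP[k ->] ->]].
  by apply: linear_closedD; [exact: Al|exact: UA|exact: linear_closedZ].
have /eqP e : U == (U + <[x]>)%VS by rewrite eqEdim addvSl dimUx.
by case/negP: xU; rewrite e; apply: (subvP (addvSr _ _)); apply: memv_line.
Qed.

(** Some coordinate of z minus its projection to the subspace is nonzero; rescaling that coordinate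
    gives the form. *)
Lemma exists_separating_form A z : linear_closed A -> ~ A z ->
  exists f : V -> K, [/\ scalar f, f z = 1 & forall x, A x -> f x = 0].
Proof.
move=> Al nAz; have [U UA] := linear_closed_vspace Al.
pose r j x := coord (vbasis {:V}) j (x - projv U x).
have r_lin j a x y : r j (a *: x + y) = a * r j x + r j y.
  by rewrite /r [projv U _]linearP opprD addrACA -scalerBr linearP.
have [j rzj] : exists j, r j z != 0.
  apply: contrapT => h; apply: nAz; apply/UA.
  have /eqP : z - projv U z = 0.
    rewrite (coord_vbasis (memvf (z - projv U z))) big1 // => j _.
    rewrite -/(r j z); have [->|rz] := eqVneq (r j z) 0; first by rewrite scale0r.
    by case: h; exists j.
  by rewrite subr_eq0 => /eqP ->; exact: memv_proj.
exists (fun x => (r j z)^-1 * r j x); split.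
- by move=> a x y; rewrite r_lin; ring.
- by rewrite mulVf.
by move=> x /UA xU; rewrite /r (projv_id xU) subrr linear0 mulr0.
Qed.

End LinearClosedSets.

(** * The Lie algebra of a unipotent algebraic group *)

Section LieAlgebraOfGroup.
Local Open Scope classical_set_scope.
Local Open Scope ring_scope.
Variables (K : numFieldType) (n : nat) (G : set 'M[K]_n).
Hypothesis hG : unipotent_group G.

Lemma unipotent_upperP (A : 'M[K]_n) :
  unipotent_upper A <-> above_diag 1 (A - 1%:M).
Proof.
split=> hA i j ij.
  by rewrite !mxE hA ?subrr //; move: ij; rewrite addn1 ltnS.
by have := hA i j; rewrite addn1 ltnS => /(_ ij)/eqP; rewrite !mxE subr_eq0 => /eqP.
Qed.

Lemma group_above_diag A : G A -> above_diag 1 (A - 1%:M).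
Proof. by move=> GA; apply/unipotent_upperP; apply: hG.2. Qed.

Lemma groupM A B : G A -> G B -> G (A *m B).
Proof. by case: hG => -[[_ _ GM _] _] _; apply: GM. Qed.

Lemma group1 : G 1%:M.
Proof. by case: hG => -[[]]. Qed.

Lemma group_zero_set :
  exists I : set (mpoly (n * n) K), forall A, G A <-> zero_set I (mxvec A).
Proof.
case: hG => -[_ [I GI]] _; exists I => A; rewrite -GI; split=> [GA|].
  by exists A.
by move=> [B GB /(can_inj mxvecK) <-].
Qed.

(** Along F each equation of G becomes a polynomial in t having all positive integers as roots. *)
Lemma upoly_in_group (F : K -> 'M[K]_n) : mx_entries (@upolyfun K) F ->
  (forall m : nat, G (F m.+1%:R)) -> forall t, G (F t).
Proof.
move=> pF GF t; have [I GI] := group_zero_set; apply/GI => p Ip.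
apply: (@upolyfun_eq0 _ (fun t => eval_at (mxvec (F t)) p)) => [|m].
  apply: fun_subalg_eval => [|j]; first exact: upolyfun_subalg.
  by apply: mx_entries_linear_mx => //; exact: upolyfun_subalg.
exact: (iffLR (GI _) (GF m)).
Qed.

(** The generators of the one-parameter subgroups of G; strict triangularity makes [expm] the true
    exponential. *)
Definition lie (X : 'M[K]_n) : Prop :=
  above_diag 1 X /\ forall t, G (expm (t *: X)).

Lemma upoly_scale (X : 'M[K]_n) : mx_entries (@upolyfun K) (fun t => t *: X).
Proof.
apply: mx_entriesZ; [exact: upolyfun_subalg|exact: upolyfun_id|].
by apply: mx_entries_cst; exact: upolyfun_subalg.
Qed.

(** The positive powers of A are the values of exp(t log A) at positive integers, and G is Zariski
    closed. *)
Lemma lie_logm A : G A -> lie (logm A).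
Proof.
move=> GA; have hA := group_above_diag GA; have hX := logm_above_diag hA.
split=> //; apply: upoly_in_group => [|m].
  by apply: mx_entries_expm; [exact: upolyfun_subalg|exact: upoly_scale].
elim: m => [|m IH]; first by rewrite scale1r logmK.
by rewrite -natr1 expmZD // scale1r logmK //; apply: groupM.
Qed.

Lemma lie_expm X : lie X -> G (expm X).
Proof. by move=> [_ /(_ 1)]; rewrite scale1r. Qed.

Lemma lieZ a X : lie X -> lie (a *: X).
Proof.
by move=> [hX GX]; split=> [|t]; [exact: above_diagZ | rewrite scalerA].
Qed.

Lemma lie0 : lie 0.
Proof. by split=> [|t]; [exact: above_diag0 | rewrite scaler0 expm0; exact: group1]. Qed.

(** Strict triangularity and membership in G are polynomial conditions on t, so they extend from
    nonzero t to t = 0. *)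
Lemma lie_upoly_limit (P : K -> 'M[K]_n) : mx_entries (@upolyfun K) P ->
  (forall t, t != 0 -> lie (P t)) -> lie (P 0).
Proof.
move=> pP lP; split=> [i j ij|s].
  apply: (upolyfun_eq0_off0 (pP i j)) => t /lP[+ _]; exact.
apply: (@upoly_in_group (fun t => expm (s *: P t))) => [|m].
  apply: mx_entries_expm; first exact: upolyfun_subalg.
  apply: mx_entriesZ => //; first exact: upolyfun_subalg.
  by apply: fun_subalg_cst; exact: upolyfun_subalg.
by have [_] := lP _ (natS_neq0 K m); apply.
Qed.

(* (exp (tX) - 1) / t, extended polynomially to t = 0. *)
Definition expm_quot (t : K) (X : 'M[K]_n) : 'M[K]_n :=
  X + t *: \sum_(k < n) t ^+ k *: divpow k.+2 X.

Lemma expm_quotE t X : above_diag 1 X ->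
  expm (t *: X) = 1%:M + t *: expm_quot t X.
Proof.
move=> hX; rewrite expm_decomp; last exact: above_diagZ.
rewrite -addrA /expm_quot; congr (_ + _); rewrite scalerDr; congr (_ + _).
rewrite !scaler_sumr; apply: eq_bigr => k _.
by rewrite divpowZ; move: (divpow _ _) => D; rewrite !scalerA -mulrA -!exprS.
Qed.

Lemma expm_quot0 X : expm_quot 0 X = X.
Proof. by rewrite /expm_quot scale0r addr0. Qed.

Lemma upoly_expm_quot (P : K -> 'M[K]_n) : mx_entries (@upolyfun K) P ->
  mx_entries (@upolyfun K) (fun t => expm_quot t (P t)).
Proof.
have sa := upolyfun_subalg K; have pid := upolyfun_id K.
move=> pP; apply: mx_entriesD => //; apply: mx_entriesZ => //.
apply: mx_entries_sum => // k _; apply: mx_entriesZ => //.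
  by apply: fun_subalgX.
exact: mx_entries_divpow.
Qed.

(* Trotter formula: X + Y is the value at t = 0 of the polynomial
   [log (exp (tX) exp (tY)) / t]. *)
Lemma lieD X Y : lie X -> lie Y -> lie (X + Y).
Proof.
move=> lX lY; have [hX GX] := lX; have [hY GY] := lY.
have sa := upolyfun_subalg K; have pid := upolyfun_id K.
pose F t := expm (t *: X) *m expm (t *: Y).
have pF : mx_entries (@upolyfun K) F.
  by apply: mx_entriesM => //; apply: mx_entries_expm => //; exact: upoly_scale.
have [P pP FP] : exists2 P, mx_entries (@upolyfun K) P &
    forall t, logm (F t) = t *: P t.
  apply: mx_upoly_div; first exact: mx_entries_logm.
  by rewrite /F !scale0r !expm0 mulmx1 -expm0 expmK //; exact: above_diag0.
have GF t : G (F t) by apply: groupM.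
have lP t : t != 0 -> lie (P t).
  move=> t0; rewrite -[P t]scale1r -(mulVf t0) -scalerA -FP.
  by apply: lieZ; apply: lie_logm.
(* The identity exp(t P(t)) = exp(tX) exp(tY), after subtracting 1 and dividing by t. *)
have quotP t : t != 0 -> expm_quot t (P t) =
    expm_quot t X + expm_quot t Y + t *: (expm_quot t X *m expm_quot t Y).
  move=> t0; have := logmK (group_above_diag (GF t)).
  rewrite FP (expm_quotE _ (lP t t0).1) /F (expm_quotE _ hX) (expm_quotE _ hY).
  move: (expm_quot t (P t)) (expm_quot t X) (expm_quot t Y) => c a b.
  rewrite mulmxDl !mulmxDr !mul1mx !mulmx1 -!scalemxAl -!scalemxAr.
  rewrite -addrA => /addrI; rewrite addrA -!scalerDr => /(scalerI t0) ->.
  by rewrite [b + a]addrC.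
suff <- : P 0 = X + Y by apply: lie_upoly_limit.
have pX (Z : 'M[K]_n) : mx_entries (@upolyfun K) (fun t => expm_quot t Z).
  by apply: upoly_expm_quot; apply: mx_entries_cst.
suff : expm_quot 0 (P 0) = expm_quot 0 X + expm_quot 0 Y by rewrite !expm_quot0.
apply/matrixP => i j; apply/eqP; rewrite -subr_eq0; apply/eqP.
(* The defect of that identity is polynomial in t and vanishes for nonzero t, hence also at t = 0,
   where it is P(0) - (X + Y). *)
pose E t := expm_quot t (P t) -
  (expm_quot t X + expm_quot t Y + t *: (expm_quot t X *m expm_quot t Y)).
have pE : mx_entries (@upolyfun K) E.
  apply: mx_entriesD => //; first exact: upoly_expm_quot.
  apply: mx_entriesN => //; apply: mx_entriesD => //; first exact: mx_entriesD.
  by apply: mx_entriesZ => //; apply: mx_entriesM.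
have entryB (M N : 'M[K]_n) : M i j - N i j = (M - N) i j by rewrite !mxE.
have := upolyfun_eq0_off0 (pE i j) _ 0.
rewrite entryB /E scale0r addr0; apply => t t0.
by rewrite quotP // subrr mxE.
Qed.

Lemma lie_linear_closed : linear_closed lie.
Proof. by split=> [|a x y lx ly]; [exact: lie0 | apply: lieD => //; exact: lieZ]. Qed.

Lemma lie_Ad A B X : G A -> G B -> A *m B = 1%:M -> lie X -> lie (A *m X *m B).
Proof.
move=> GA GB AB [hX GX]; have BA := mulmx1C AB; split=> [|t].
  apply: above_diagMr; last exact/unipotent_above_diag0/group_above_diag.
  apply: above_diagMl => //; exact/unipotent_above_diag0/group_above_diag.
rewrite scalemxAl scalemxAr -mulmx_expm_conj //.
by apply: groupM => //; apply: groupM.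
Qed.

(** Otherwise a linear form f kills the Lie algebra but not [X, Y]. Then f(Ad(exp(tX)) Y) is a
    polynomial in t that vanishes identically, while its coefficient of t is f([X, Y]). *)
Lemma lie_bracket X Y : lie X -> lie Y -> lie (X *m Y - Y *m X).
Proof.
move=> lX lY; have [hX GX] := lX; have [hY _] := lY.
have <- : ad_divpow 1 X Y = X *m Y - Y *m X.
  by have := ad_divpowS 0 X Y; rewrite mulr1n scale1r !ad_divpow0.
apply: contrapT => /(exists_separating_form lie_linear_closed)[f [f_lin f1 f0]].
have f_sum t : \sum_(k < n.+2) t ^+ k * f (ad_divpow k X Y) = 0.
  transitivity (f (expm (t *: X) *m Y *m expm (- (t *: X)))); last first.
    apply: f0; apply: lie_Ad => //; last by rewrite expmN //; exact: above_diagZ.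
    by rewrite -scaleNr.
  (* With n + 2 terms the coefficient of t is present whatever n is. *)
  rewrite (@expm_conj _ _ n.+2) //; last 3 first.
  - by rewrite -addn2 leq_addr.
  - exact: above_diagZ.
  - exact: above_diagW hY.
  rewrite scalar_map_sum //; apply: eq_bigr => k _.
  by rewrite ad_divpowZ (scalar_mapZ f_lin).
have := @upolyfun_coef _ _ (fun k => f (ad_divpow k X Y)) f_sum 1 isT.
by rewrite f1 => /eqP; rewrite oner_eq0.
Qed.

Lemma lie_vspace : exists g : {vspace 'M[K]_n}, forall X, X \in g <-> lie X.
Proof. exact: linear_closed_vspace lie_linear_closed. Qed.

End LieAlgebraOfGroup.

(** * Exponential charts *)

Section ExponentialParametrization.
Local Open Scope classical_set_scope.
Local Open Scope ring_scope.
Variables (K : numFieldType) (n : nat) (U : {vspace 'M[K]_n}) (A B : 'M[K]_n).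
Hypothesis U_above : forall X, X \in U -> above_diag 1 X.
Hypothesis AB : A *m B = 1%:M.

(** The factor A is there because the slice is first found for a conjugate of H and then carried
    back to H; A = 1 describes G itself. *)
Definition exp_translate : set 'M[K]_n := [set expm X *m A | X in [set X | X \in U]].

Definition exp_chart (y : 'rV[K]_(\dim U)) : 'rV[K]_(n * n) :=
  mxvec (expm (\sum_j y 0 j *: (vbasis U)`_j) *m A).

Definition log_chart (x : 'rV[K]_(n * n)) : 'rV[K]_(\dim U) :=
  \row_j coord (vbasis U) j (logm (vec_mx x *m B)).

Lemma exp_chart_polymap : polymap exp_chart.
Proof.
have sa := polyfun_subalg K (\dim U).
apply: mx_entries_linear_mx => //; apply: mx_entriesM => //; last first.
  exact: mx_entries_cst.
apply: mx_entries_expm => //; apply: mx_entries_sum => // j _.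
apply: mx_entriesZ => //; first exact: polyfun_coord.
exact: mx_entries_cst.
Qed.

Lemma log_chart_polymap : polymap log_chart.
Proof.
have sa := polyfun_subalg K (n * n).
move=> i j; apply: (@fun_subalg_eq _ _ _ (fun x =>
  coord (vbasis U) j (logm (vec_mx x *m B)))) => [x|]; first by rewrite mxE.
apply: mx_entries_scalar => //; first exact: linearP.
apply: mx_entries_logm => //; apply: mx_entriesM => //; last first.
  exact: mx_entries_cst.
by apply: mx_entries_linear_mx => //; exact: polyfun_id.
Qed.

Lemma exp_chart_mem (y : 'rV[K]_(\dim U)) : \sum_j y 0 j *: (vbasis U)`_j \in U.
Proof.
by apply: memv_suml => j _; apply: memvZ; apply: vbasis_mem; rewrite mem_nth ?size_tuple.
Qed.

Lemma exp_chartK : cancel exp_chart log_chart.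
Proof.
move=> y; apply/rowP => j; rewrite mxE /exp_chart mxvecK -mulmxA AB mulmx1.
rewrite expmK; last by apply: U_above; apply: exp_chart_mem.
exact: coord_sum_free (basis_free (vbasisP U)).
Qed.

Lemma range_exp_chart : mxset exp_translate = range exp_chart.
Proof.
apply/seteqP; split=> x.
  move=> [_ [X XU <-] <-]; exists (\row_j coord (vbasis U) j X) => //.
  rewrite /exp_chart [in RHS](coord_vbasis XU); congr (mxvec (expm _ *m A)).
  by apply: eq_bigr => j _; rewrite mxE.
move=> [y _ <-]; exists (expm (\sum_j y 0 j *: (vbasis U)`_j) *m A) => //.
by exists (\sum_j y 0 j *: (vbasis U)`_j) => //; apply: exp_chart_mem.
Qed.

Lemma exp_translate_algebraic : algebraic_set (mxset exp_translate).
Proof.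
rewrite range_exp_chart.
exact: range_algebraic_set exp_chart_polymap log_chart_polymap exp_chartK.
Qed.

Lemma exp_translate_isomorphic :
  isomorphic (mxset exp_translate) [set: 'rV[K]_(\dim U)].
Proof.
rewrite range_exp_chart.
exact: range_isomorphic exp_chart_polymap log_chart_polymap exp_chartK.
Qed.

Lemma exp_translate_dim d : has_dim (mxset exp_translate) d -> d = \dim U.
Proof.
rewrite range_exp_chart.
exact: range_dim exp_chart_polymap log_chart_polymap exp_chartK d.
Qed.

End ExponentialParametrization.

(** * Slices *)

Section LogarithmCongruences.
Local Open Scope ring_scope.
Variables (K : numFieldType) (n : nat).
Implicit Types X Y Z A : 'M[K]_n.

(** exp(Z) A agrees with exp(log A + Z) modulo N_(k+1), and [logm_congr] carries the congruence over
    to logarithms. *)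
Lemma logm_expm_mull k A Z :
  (0 < k)%N -> above_diag 1 (A - 1%:M) -> above_diag k Z ->
  above_diag k.+1 (logm (expm Z *m A) - (logm A + Z)).
Proof.
move=> k0 hA hZ; have hZ1 : above_diag 1 Z by apply: above_diagW hZ.
have hX := logm_above_diag hA; have hXZ := above_diagD hX hZ1.
rewrite -(expmK hXZ); apply: logm_congr; try exact: expm_unipotent.
  by apply: unipotentM => //; exact: expm_unipotent.
by have := mul_expm_congrl k0 hX hZ; rewrite logmK.
Qed.

Lemma logm_expm_mulr k A Z :
  (0 < k)%N -> above_diag 1 (A - 1%:M) -> above_diag k Z ->
  above_diag k.+1 (logm (A *m expm Z) - (logm A + Z)).
Proof.
move=> k0 hA hZ; have hZ1 : above_diag 1 Z by apply: above_diagW hZ.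
have hX := logm_above_diag hA; have hXZ := above_diagD hX hZ1.
rewrite -(expmK hXZ); apply: logm_congr; try exact: expm_unipotent.
  by apply: unipotentM => //; exact: expm_unipotent.
by have := mul_expm_congr k0 hX hZ; rewrite logmK.
Qed.

End LogarithmCongruences.

(** * Freeness along the filtration and the forms xi and eta *)

Section Slice.
Local Open Scope classical_set_scope.
Local Open Scope ring_scope.
Variables (K : numFieldType) (n : nat) (G : set 'M[K]_n) (g : {vspace 'M[K]_n}).
Hypothesis hG : unipotent_group G.
Hypothesis gG : forall X, X \in g <-> lie G X.

Let g_above X : X \in g -> above_diag 1 X.
Proof. by move=> /gG[]. Qed.

Let g_expm X : X \in g -> G (expm X).
Proof. by move=> /gG; apply: lie_expm. Qed.

Let g_logm A : G A -> logm A \in g.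
Proof. by move=> GA; apply/gG; apply: lie_logm. Qed.

Let g_bracket X Y : X \in g -> Y \in g -> X *m Y - Y *m X \in g.
Proof. by move=> /gG lX /gG lY; apply/gG; apply: lie_bracket. Qed.

Let g_Ad A B X : G A -> G B -> A *m B = 1%:M -> X \in g -> A *m X *m B \in g.
Proof. by move=> GA GB AB /gG lX; apply/gG; apply: lie_Ad. Qed.

(** The subspace [w, g] + N_k; xi is chosen to kill such a space. *)
Definition bracket_mod (k : nat) (w Y : 'M[K]_n) : Prop :=
  exists2 X, X \in g & above_diag k (Y - (w *m X - X *m w)).

Lemma bracket_mod_linear_closed k w : linear_closed (bracket_mod k w).
Proof.
split=> [|a x y [X Xg hX] [Y Yg hY]].
  exists 0; first exact: mem0v.
  by rewrite mulmx0 mul0mx !subr0; exact: above_diag0.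
exists (a *: X + Y); first by apply: memvD => //; apply: memvZ.
have -> : a *: x + y - (w *m (a *: X + Y) - (a *: X + Y) *m w) =
    a *: (x - (w *m X - X *m w)) + (y - (w *m Y - Y *m w)).
  rewrite mulmxDr mulmxDl -scalemxAr -scalemxAl.
  move: (w *m X) (X *m w) (w *m Y) (Y *m w) => P Q R S.
  by apply/matrixP => i j; rewrite !mxE; ring.
by apply: above_diagD => //; apply: above_diagZ.
Qed.

Lemma bracket_mod_above k w Y : above_diag k Y -> bracket_mod k w Y.
Proof.
by move=> hY; exists 0; [exact: mem0v | rewrite mulmx0 mul0mx !subr0].
Qed.

(** The subspace K z + N_k; eta is chosen to kill such a space. *)
Definition multiple_mod (k : nat) (z Y : 'M[K]_n) : Prop :=
  exists c, above_diag k (Y - c *: z).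

Lemma multiple_mod_linear_closed k z : linear_closed (multiple_mod k z).
Proof.
split=> [|a x y [b hb] [c hc]].
  by exists 0; rewrite scale0r subr0; exact: above_diag0.
exists (a * b + c).
have -> : a *: x + y - (a * b + c) *: z = a *: (x - b *: z) + (y - c *: z).
  by apply/matrixP => i j; rewrite !mxE; ring.
by apply: above_diagD => //; apply: above_diagZ.
Qed.

(* Ad(exp w) - 1 has image in [w, g]. *)
Lemma form_Ad_invariant m (xi : 'M[K]_n -> K) t w x : scalar xi ->
  (forall Y, bracket_mod m w Y -> xi Y = 0) -> w \in g -> x \in g ->
  xi (expm (t *: w) *m x *m expm (- (t *: w))) = xi x.
Proof.
move=> xi_lin xi0 wg xg.
have hw := g_above wg; have hx := g_above xg.
have adg k : ad_divpow k w x \in g.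
  elim: k => [|k IH]; first by rewrite ad_divpow0.
  rewrite -[ad_divpow _ _ _]scale1r -(mulVf (natS_neq0 K k)) -scalerA ad_divpowS.
  by apply: memvZ; apply: g_bracket.
rewrite (@expm_conj _ _ n.+1) //; last 2 first.
- exact: above_diagZ.
- exact: above_diagW hx.
rewrite big_ord_recl ad_divpow0 (scalar_mapD xi_lin) scalar_map_sum // big1 ?addr0 //.
move=> k _; rewrite lift0 ad_divpowZ (scalar_mapZ xi_lin).
(* After multiplication by k + 1, which is invertible, the term is a bracket of w with an element of
   g. *)
suff : k.+1%:R * xi (ad_divpow k.+1 w x) = 0.
  by move/eqP; rewrite mulf_eq0 pnatr_eq0 /= => /eqP ->; rewrite mulr0.
rewrite -(scalar_mapZ xi_lin) ad_divpowS; apply: xi0.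
by exists (ad_divpow k w x) => //; rewrite subrr; exact: above_diag0.
Qed.

Variables v h : 'M[K]_n.
Hypotheses (vg : v \in g) (hg : h \in g).

(* Infinitesimal freeness of the action modulo the k-th filtration step: no
   conjugate of the line of h meets the line of v. *)
Definition free_mod (k : nat) : Prop :=
  forall A B, G A -> G B -> A *m B = 1%:M -> forall a b,
    above_diag k (b *: (A *m h *m B) - a *: v) -> a = 0 /\ b = 0.

(* Ad(exp (-x)) w = w + [w, x] + ..., where the omitted terms are brackets of x
   with z, up to the next filtration step. *)
Lemma bracket_mod_Ad m w z : (0 < m)%N -> w \in g -> above_diag m z ->
  bracket_mod m.+1 w z ->
  exists2 x, x \in g &
    above_diag m.+1 (expm (- x) *m w *m expm x - (w + z)).
Proof.
move=> m0 wg hz [x xg hzx]; exists x => //.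
have hx := g_above xg; have hw := g_above wg; have hNx := above_diagN hx.
rewrite -{2}[x]opprK (@expm_conj _ _ n.+2) //; last 2 first.
- by rewrite -addn2 leq_addr.
- exact: above_diagW hw.
have ad1 : ad_divpow 1 (- x) w = w *m x - x *m w.
  have := ad_divpowS 0 (- x) w; rewrite mulr1n scale1r !ad_divpow0 => ->.
  by rewrite mulNmx mulmxN opprK addrC.
have had k : above_diag m.+1 (ad_divpow k.+2 (- x) w).
  elim: k => [|k IH]; rewrite -[ad_divpow _ _ _]scale1r.
    rewrite -(mulVf (natS_neq0 K 1)) -scalerA ad_divpowS ad1; apply: above_diagZ.
    (* [w, x] is z up to N_(m+1), hence lies in N_m; one more bracket with x gains a diagonal. *)
    have hm : above_diag m (w *m x - x *m w).
      rewrite -[_ - _](subKr z); apply: above_diagB => //.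
      by apply: above_diagW hzx.
    apply: above_diagB; first by rewrite -add1n; apply: above_diagM.
    by rewrite -addn1; apply: above_diagM.
  rewrite -(mulVf (natS_neq0 K k.+2)) -scalerA ad_divpowS; apply: above_diagZ.
  by apply: above_diagB; [apply: above_diagMl | apply: above_diagMr] => //;
    apply: above_diagW hNx.
rewrite 2!big_ord_recl ad_divpow0 ad1 addrA.
have -> (a b c d : 'M[K]_n) : a + b + c - (a + d) = c - (d - b).
  by apply/matrixP => i j; rewrite !mxE; ring.
by apply: above_diagB => //; apply: above_diag_sum => k _; rewrite !lift0.
Qed.

Hypothesis free : free_mod n.

(** Freeness fails modulo N_1, where v and h both vanish, and holds modulo N_n; m + 1 is the first
    index at which it holds. *)
Lemma free_mod_threshold : exists m, [/\ (0 < m)%N, free_mod m.+1 & ~ free_mod m].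
Proof.
have ex : exists k, `[< free_mod k >] by exists n; apply/asboolP.
case: (ex_minnP ex) => k /asboolP fk kmin.
have k1 : (1 < k)%N.
  rewrite ltnNge; apply/negP => k1.
  have := fk 1%:M 1%:M (group1 hG) (group1 hG) (mulmx1 _) 1 1.
  rewrite mul1mx mulmx1 !scale1r => -[|/eqP]; last by rewrite oner_eq0.
  by apply: above_diagW k1 _; apply: above_diagB; apply: g_above.
case: k fk kmin k1 => [//|[//|m]] fk kmin _; exists m.+1; split=> // fm.
by have := kmin m.+1; rewrite ltnn => /(_ (asboolT fm)).
Qed.

(* Along V x H' the coordinate eta o log moves with the constant speed (b, a);
   in the direction (-a, b), where it is constant, xi o log moves with speed 1. *)
Lemma slice_forms : exists A0 B0, [/\ G A0, G B0, A0 *m B0 = 1%:M &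
  let h' := A0 *m h *m B0 in
  exists (xi eta : 'M[K]_n -> K) (a b : K),
  [/\ scalar xi /\ scalar eta, (a != 0) || (b != 0),
      (forall A s t, G A -> eta (logm (expm (s *: v) *m A *m expm (t *: h')))
         = eta (logm A) + b * s + a * t),
      (forall A t, G A ->
         xi (logm (expm (- (a * t) *: v) *m A *m expm ((b * t) *: h')))
         = xi (logm A) + t) &
      [/\ eta v = b, eta h' = a, xi (b *: h' - a *: v) = 1 &
          eta (b *: h' - a *: v) = 0]]].
Proof.
have [m [m0 fm1 nfm]] := free_mod_threshold.
(* Failure of freeness modulo N_m provides the conjugation and a nonzero pair (a, b). *)
have [A0 [B0 [GA0 GB0 AB0 [a [b [hz ab]]]]]] : exists A B, [/\ G A, G B, A *m B = 1%:M &
    exists a b, above_diag m (b *: (A *m h *m B) - a *: v) /\ ~ (a = 0 /\ b = 0)].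
  apply: contrapT => nex; apply: nfm => A B GA GB AB a b hab.
  by apply: contrapT => nab; apply: nex; exists A, B; split=> //; exists a, b.
exists A0, B0; split=> //; set h' := A0 *m h *m B0; rewrite -/h' in hz.
set z := _ - _ in hz; pose w := a *: v.
have BA0 := mulmx1C AB0.
have h'g : h' \in g by apply: g_Ad.
have wg : w \in g by apply: memvZ.
have free' A B c d : G A -> G B -> A *m B = 1%:M ->
    above_diag m.+1 (d *: (A *m h' *m B) - c *: v) -> c = 0 /\ d = 0.
  move=> GA GB AB; rewrite /h'.
  have -> : A *m (A0 *m h *m B0) *m B = (A *m A0) *m h *m (B0 *m B).
    by rewrite !mulmxA.
  apply: fm1; [exact: groupM|exact: groupM|].
  by rewrite mulmxA -(mulmxA A) AB0 mulmx1.
have zE : b *: h' = w + z by rewrite /z addrC subrK.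
(* Otherwise b h' = w + z is, modulo N_(m+1), conjugate to w = a v under some exp(x), which freeness
   modulo N_(m+1) forbids. *)
have nbr : ~ bracket_mod m.+1 w z.
  move=> /(bracket_mod_Ad m0 wg hz)[x xg hx].
  have gx := g_expm xg; have gNx : G (expm (- x)) by apply: g_expm; rewrite memvN.
  have ax := g_above xg; have exx := expmN ax; have exxl := expmNl ax.
  apply: ab; apply: (free' (expm x) (expm (- x))) => //.
  have hx' := above_diagMr
    (above_diagMl (unipotent_above_diag0 (group_above_diag hG gx)) hx)
    (unipotent_above_diag0 (group_above_diag hG gNx)).
  rewrite -zE mulmxBr mulmxBl !mulmxA exx mul1mx -mulmxA exx mulmx1 in hx'.
  by move: hx'; rewrite -scalemxAr -scalemxAl => /above_diagN; rewrite opprB.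
have [xi [xi_lin xiz xi0]] := exists_separating_form (bracket_mod_linear_closed _ _) nbr.
(* If there were no such i, then v = c z and h' = c' z modulo N_(m+1), so c h' - c' v lies in
   N_(m+1). Freeness gives c = c' = 0, hence v lies in N_(m+1), and the pair (-1, 0) contradicts
   freeness. *)
have [i [i0 im [Rv Rh] nR]] : exists i, [/\ (0 < i)%N, (i <= m)%N,
    multiple_mod i z v /\ multiple_mod i z h' &
    ~ (multiple_mod i.+1 z v /\ multiple_mod i.+1 z h')].
  apply: contrapT => nex.
  have R k : (k <= m)%N -> multiple_mod k.+1 z v /\ multiple_mod k.+1 z h'.
    elim: k => [_|k IH km].
      by split; exists 0; rewrite scale0r subr0; apply: g_above.
    by apply: contrapT => nk; apply: nex; exists k.+1; split=> //; apply: IH; apply: ltnW.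
  have [[c hc] [c' hc']] := R m (leqnn m).
  have G1 := group1 hG.
  have [c0 c'0] : c' = 0 /\ c = 0.
    apply: (free' 1%:M 1%:M) => //; rewrite ?mulmx1 // mul1mx.
    have -> : c *: h' - c' *: v = c *: (h' - c' *: z) - c' *: (v - c *: z).
      by apply/matrixP => p q; rewrite !mxE; ring.
    by apply: above_diagB; apply: above_diagZ.
  have [/eqP] : (-1 : K) = 0 /\ (0 : K) = 0.
    apply: (free' 1%:M 1%:M) => //; rewrite ?mulmx1 //.
    by move: hc; rewrite c'0 !scale0r subr0 sub0r scaleN1r opprK.
  by rewrite oppr_eq0 oner_eq0.
have hzi : above_diag i z by apply: above_diagW hz.
have above_multiple Y : multiple_mod i z Y -> above_diag i Y.
  move=> [c hc]; rewrite -[Y](subrK (c *: z)); apply: above_diagD => //.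
  exact: above_diagZ.
have hv := above_multiple _ Rv; have hh' := above_multiple _ Rh.
have [eta0 [eta0_lin eta0R eta0n]] : exists eta : 'M[K]_n -> K, [/\ scalar eta,
    forall Y, multiple_mod i.+1 z Y -> eta Y = 0 & (eta v != 0) || (eta h' != 0)].
  have [Mv|nMv] := pselect (multiple_mod i.+1 z v).
    have nMh : ~ multiple_mod i.+1 z h' by move=> Mh; apply: nR.
    have [eta [? e1 ?]] := exists_separating_form (multiple_mod_linear_closed _ _) nMh.
    by exists eta; split=> //; rewrite e1 oner_eq0 orbT.
  have [eta [? e1 ?]] := exists_separating_form (multiple_mod_linear_closed _ _) nMv.
  by exists eta; split=> //; rewrite e1 oner_eq0.
have ab0 : (a != 0) || (b != 0).
  by rewrite -negb_and; apply/negP => /andP[/eqP ? /eqP ?]; apply: ab.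
have eta0z : eta0 z = 0.
  by apply: eta0R; exists 1; rewrite scale1r subrr; exact: above_diag0.
have eta0rel : b * eta0 h' = a * eta0 v.
  apply/eqP; rewrite -subr_eq0 -!(scalar_mapZ eta0_lin) -(scalar_mapB eta0_lin).
  by rewrite -/z eta0z.
(* Since [eta0] kills z = b h' - a v, its values on (v, h') are proportional to (b, a); dividing by
   c normalizes them. *)
have [c [c0 etav etah]] : exists c, [/\ c != 0, eta0 v = c * b & eta0 h' = c * a].
  have [b0|b0] := eqVneq b 0.
    rewrite b0 eqxx orbF in ab0; exists (eta0 h' / a).
    have v0 : eta0 v = 0.
      by move/eqP: eta0rel; rewrite b0 mul0r eq_sym mulf_eq0 (negbTE ab0) => /eqP.
    rewrite v0 b0 mulr0 divfK //; split=> //.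
    by rewrite v0 eqxx /= in eta0n; rewrite mulf_neq0 // invr_eq0.
  have hE : eta0 h' = eta0 v / b * a.
    by apply: (mulfI b0); rewrite eta0rel mulrA (mulrC b) divfK // mulrC.
  exists (eta0 v / b); rewrite divfK //; split=> //.
  apply: contraTneq eta0n => e; rewrite hE e mul0r eqxx orbF.
  by move/eqP: e; rewrite mulf_eq0 invr_eq0 (negbTE b0) orbF => ->.
pose eta Y := c^-1 * eta0 Y.
have eta_lin : scalar eta.
  by move=> k x y; rewrite /eta eta0_lin; ring.
have eta_v : eta v = b by rewrite /eta etav mulKf.
have eta_h : eta h' = a by rewrite /eta etah mulKf.
have eta_above Y : above_diag i.+1 Y -> eta Y = 0.
  move=> hY; rewrite /eta eta0R ?mulr0 //.
  by exists 0; rewrite scale0r subr0.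
exists xi, eta, a, b; split=> //; last first.
- by split=> //; rewrite /eta -/z eta0z mulr0.
(* Split exp(tw + tz) as exp(tw) exp(tz) modulo N_(m+1). Conjugation by exp(-tw) leaves xi o log
   unchanged, and the factor exp(tz) adds t. *)
- move=> A t GA.
  have hA := group_above_diag hG GA.
  pose E := expm (t *: w); pose E' := expm (- (t *: w)).
  have twg : t *: w \in g by apply: memvZ.
  have atw := g_above twg.
  have GE : G E by apply: g_expm.
  have GE' : G E' by apply: g_expm; rewrite memvN.
  have EE' : E' *m E = 1%:M by apply: expmNl.
  have xE : E' *m A *m E = expm (E' *m logm A *m E).
    by rewrite -mulmx_expm_conj ?logmK //; exact: mulmx1C.
  have x'g : E' *m logm A *m E \in g by apply: g_Ad => //; apply: g_logm.
  have -> : - (a * t) *: v = - (t *: w) by rewrite scaleNr /w scalerA mulrC.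
  have -> : (b * t) *: h' = t *: w + t *: z by rewrite mulrC -scalerA zE scalerDr.
  rewrite -/E'.
  have atz : above_diag m (t *: z) by apply: above_diagZ.
  have atz1 : above_diag 1 (t *: z) by apply: above_diagW atz.
  have hEA : above_diag 1 (E' *m A *m E - 1%:M).
    by apply: (group_above_diag hG); apply: groupM => //; apply: groupM.
  have hEA1 : above_diag 1 (E' *m A - 1%:M).
    by apply: (group_above_diag hG); apply: groupM.
  have congr1 : above_diag m.+1
      (logm (E' *m A *m expm (t *: w + t *: z)) - logm (E' *m A *m E *m expm (t *: z))).
    apply: logm_congr.
    - by apply: unipotentM => //; apply: expm_unipotent; apply: above_diagD.
    - by apply: unipotentM => //; apply: expm_unipotent.
    rewrite -[E' *m A *m E *m _]mulmxA -mulmxBr.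
    apply: above_diagMl; first exact: unipotent_above_diag0.
    by apply: above_diagBC; apply: mul_expm_congr.
  have congr2 := logm_expm_mulr m0 hEA atz.
  have xi_eq X Y : above_diag m.+1 (X - Y) -> xi X = xi Y.
    move=> hXY; apply/eqP; rewrite -subr_eq0 -(scalar_mapB xi_lin).
    by rewrite xi0 //; apply: bracket_mod_above.
  rewrite (xi_eq _ _ congr1) (xi_eq _ _ congr2) (scalar_mapD xi_lin).
  rewrite (scalar_mapZ xi_lin) xiz mulr1 xE (expmK (g_above x'g)); congr (_ + _).
  rewrite -(form_Ad_invariant (- t) xi_lin xi0 wg (g_logm GA)).
  by rewrite !scaleNr opprK.
(* As v and h' lie in N_i, the logarithm changes by s v + t h' modulo N_(i+1), which eta kills. *)
move=> A s t GA; have hA := group_above_diag hG GA.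
have hsv : above_diag i (s *: v) by apply: above_diagZ.
have hth : above_diag i (t *: h') by apply: above_diagZ.
have hsA : above_diag 1 (expm (s *: v) *m A - 1%:M).
  by apply: unipotentM => //; apply: expm_unipotent; apply: above_diagW hsv.
have eta_eq X Y : above_diag i.+1 (X - Y) -> eta X = eta Y.
  move=> hXY; apply/eqP; rewrite -subr_eq0 -(scalar_mapB eta_lin).
  by rewrite eta_above.
rewrite (eta_eq _ _ (logm_expm_mulr i0 hsA hth)) (scalar_mapD eta_lin).
rewrite (eta_eq _ _ (logm_expm_mull i0 hA hsv)) (scalar_mapD eta_lin).
by rewrite !(scalar_mapZ eta_lin) eta_v eta_h (mulrC s) (mulrC t).
Qed.

End Slice.

(** * Construction of the slice and of the inverse map *)

Section GlobalSlice.
Local Open Scope classical_set_scope.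
Local Open Scope ring_scope.
Variables (K : numFieldType) (n : nat).

(** Subtracting f x / f z times z projects W onto U along z, so W is the direct sum of U and the
    line of z. *)
Lemma dim_form_kernel (V : vectType K) (W U : {vspace V}) (f : V -> K) z :
  scalar f -> z \in W -> f z != 0 ->
  (forall x, x \in U <-> x \in W /\ f x = 0) -> \dim W = (\dim U).+1.
Proof.
move=> f_lin zW fz UW.
have -> : W = (U + <[z]>)%VS.
  apply/eqP; rewrite eqEsubv; apply/andP; split; apply/subvP => x.
    move=> xW; rewrite -[x](subrK (f x / f z *: z)); apply: memv_add.
      apply/UW; split; first by apply: memvB => //; apply: memvZ.
      by rewrite (scalar_mapB f_lin) (scalar_mapZ f_lin) divfK // subrr.
    by apply: memvZ; apply: memv_line.
  move=> /memv_addP[u /UW[uW _] [w /vlineP[k ->] ->]].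
  by apply: memvD => //; apply: memvZ.
have z0 : z != 0 by apply: contraNneq fz => ->; rewrite (scalar_map0 f_lin).
rewrite dimv_disjoint_sum; first by rewrite dim_vline z0 addn1.
apply/eqP; rewrite -subv0; apply/subvP => x /memv_capP[/UW[_ fx0] /vlineP[k xE]].
move: fx0; rewrite xE (scalar_mapZ f_lin) => /eqP.
by rewrite mulf_eq0 (negbTE fz) orbF => /eqP ->; rewrite scale0r mem0v.
Qed.

Lemma group_exp_translate (G : set 'M[K]_n) (g : {vspace 'M[K]_n}) :
  unipotent_group G -> (forall X, X \in g <-> lie G X) ->
  G = exp_translate g 1%:M.
Proof.
move=> hG gG; apply/seteqP; split=> A.
  move=> GA; exists (logm A); first exact/gG/lie_logm.
  by rewrite mulmx1 logmK //; apply: group_above_diag GA.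
by move=> [X /gG lX <-]; rewrite mulmx1; exact: lie_expm lX.
Qed.

Lemma expm_line (g : {vspace 'M[K]_n}) (G : set 'M[K]_n) v :
  G = exp_translate g 1%:M -> g = <[v]>%VS ->
  forall A, G A <-> exists t, A = expm (t *: v).
Proof.
move=> -> -> A; split; first by move=> [X /vlineP[t ->] <-]; exists t; rewrite mulmx1.
by move=> [t ->]; exists (t *: v); [exact: memvZ (memv_line v)|rewrite mulmx1].
Qed.

Lemma dim1_vline (V : vectType K) (g : {vspace V}) :
  \dim g = 1%N -> exists2 v, v != 0 & g = <[v]>%VS.
Proof.
move=> dg; have g0 : g != 0%VS by rewrite -dimv_eq0 dg.
exists (vpick g); first by rewrite vpick0.
apply/esym/eqP; rewrite eqEdim dg dim_vline vpick0 g0 leqnn andbT.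
by apply/subvP => x /vlineP[k ->]; apply: memvZ; apply: memv_pick.
Qed.

Variables (G V H : set 'M[K]_n) (g : {vspace 'M[K]_n}) (v h : 'M[K]_n).
Hypothesis hG : unipotent_group G.
Hypothesis gG : forall X, X \in g <-> lie G X.
Hypotheses (vg : v \in g) (hg : h \in g).
Hypothesis VE : forall A, V A <-> exists t, A = expm (t *: v).
Hypothesis HE : forall A, H A <-> exists t, A = expm (t *: h).
Hypothesis free : free_mod G v h n.

Let g_above X : X \in g -> above_diag 1 X.
Proof. by move=> /gG[]. Qed.

Let g_expm X : X \in g -> G (expm X).
Proof. by move=> /gG; apply: lie_expm. Qed.

(** With U the common kernel of xi and eta in g, exp(U) is a slice for H' = A0 H B0; since A0 exp(t
    h) = exp(t h') A0, its translate by A0 is one for H. *)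
Lemma global_slice_exists : exists (U : {vspace 'M[K]_n}) (A0 B0 : 'M[K]_n),
  [/\ \dim g = (\dim U).+2, forall X, X \in U -> above_diag 1 X,
      A0 *m B0 = 1%:M & global_slice V H G (exp_translate U A0)].
Proof.
have [A0 [B0 [GA0 GB0 AB0]]] := slice_forms hG gG vg hg free.
set h' := A0 *m h *m B0 => /=.
move=> [xi [eta [a [b [[xi_lin eta_lin] ab eta_act xi_act [eta_v eta_h xi_z eta_z]]]]]].
set z := _ - _ in xi_z eta_z.
have BA0 := mulmx1C AB0.
have h'g : h' \in g by apply/gG; apply: lie_Ad => //; apply/gG.
have zg : z \in g by apply: memvB; apply: memvZ.
have [U1 U1P] : exists U1 : {vspace 'M[K]_n}, forall X,
    X \in U1 <-> X \in g /\ xi X = 0.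
  apply: linear_closed_vspace; split; first by rewrite mem0v (scalar_map0 xi_lin).
  move=> c x y [xg x0] [yg y0]; split; first by apply: memvD => //; apply: memvZ.
  by rewrite xi_lin x0 y0 mulr0 addr0.
have [U UP] : exists U : {vspace 'M[K]_n}, forall X,
    X \in U <-> X \in U1 /\ eta X = 0.
  apply: linear_closed_vspace; split; first by rewrite mem0v (scalar_map0 eta_lin).
  move=> c x y [xg x0] [yg y0]; split; first by apply: memvD => //; apply: memvZ.
  by rewrite eta_lin x0 y0 mulr0 addr0.
have dimU : \dim g = (\dim U).+2.
  have -> := dim_form_kernel xi_lin zg _ U1P; last by rewrite xi_z oner_neq0.
  (* Correcting by a multiple of z moves into ker xi without changing eta, so eta stays nonzero on
     ker xi. *)
  have proj Y : Y \in g -> Y - xi Y *: z \in U1.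
    move=> Yg; apply/U1P; split; first by apply: memvB => //; apply: memvZ.
    by rewrite (scalar_mapB xi_lin) (scalar_mapZ xi_lin) xi_z mulr1 subrr.
  have proj_eta Y : eta (Y - xi Y *: z) = eta Y.
    by rewrite (scalar_mapB eta_lin) (scalar_mapZ eta_lin) eta_z mulr0 subr0.
  congr S; case/orP: ab => [a0|b0].
    by apply: (dim_form_kernel eta_lin (proj _ h'g)) => //; rewrite proj_eta eta_h.
  by apply: (dim_form_kernel eta_lin (proj _ vg)) => //; rewrite proj_eta eta_v.
have Ug X : X \in U -> X \in g by move=> /UP[/U1P[]].
have U_above X : X \in U -> above_diag 1 X by move=> /Ug; exact: g_above.
(* A direction in which eta o log moves with unit speed. *)
have [s1 [t1 st1]] : exists s1 t1, b * s1 + a * t1 = 1.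
  have [b0|b0] := eqVneq b 0.
    rewrite b0 eqxx orbF in ab.
    by exists 0, a^-1; rewrite mulr0 add0r mulfV.
  by exists b^-1, 0; rewrite mulr0 addr0 mulfV.
(* Moving by -Q (s1, t1) makes eta o log vanish; [tau] is the value of xi o log left over, removed
   by moving along (-a, b), which keeps eta o log fixed. [alpha] and [beta] are the total
   parameters. *)
pose Q A := eta (logm (A *m B0)).
pose tau A := xi (logm
  (expm ((- (Q A * s1)) *: v) *m (A *m B0) *m expm ((- (Q A * t1)) *: h'))).
pose alpha A := Q A * s1 - a * tau A.
pose beta A := Q A * t1 + b * tau A.
have vD s t : expm (s *: v) *m expm (t *: v) = expm ((s + t) *: v).
  by rewrite expmZD //; exact: g_above.
have hD s t : expm (s *: h) *m expm (t *: h) = expm ((s + t) *: h).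
  by rewrite expmZD //; exact: g_above.
have h'D s t : expm (s *: h') *m expm (t *: h') = expm ((s + t) *: h').
  by rewrite expmZD //; exact: g_above.
have Gv t : G (expm (t *: v)) by apply: g_expm; apply: memvZ.
have Gh t : G (expm (t *: h)) by apply: g_expm; apply: memvZ.
have Gh' t : G (expm (t *: h')) by apply: g_expm; apply: memvZ.
have conj_h t : A0 *m expm (t *: h) *m B0 = expm (t *: h').
  by rewrite mulmx_expm_conj // -scalemxAr -scalemxAl.
have shift_v t (A : 'M[K]_n) : expm (- t *: v) *m (expm (t *: v) *m A) = A.
  by rewrite mulmxA vD addNr scale0r expm0 mul1mx.
have shift_h t (A : 'M[K]_n) : A *m expm (t *: h) *m expm (- t *: h) = A.
  by rewrite -mulmxA hD subrr scale0r expm0 mulmx1.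
have slice_mem A : G A ->
    exists2 u, u \in U & expm (- alpha A *: v) *m A *m expm (- beta A *: h) = expm u *m A0.
  move=> GA.
  pose A1 := expm ((- (Q A * s1)) *: v) *m (A *m B0) *m expm ((- (Q A * t1)) *: h').
  pose A2 := expm (- alpha A *: v) *m (A *m B0) *m expm (- beta A *: h').
  have GAB : G (A *m B0) by apply: groupM.
  have GA1 : G A1 by apply: groupM => //; apply: groupM.
  have GA2 : G A2 by apply: groupM => //; apply: groupM.
  have A2E : A2 = expm (- (a * - tau A) *: v) *m A1 *m expm ((b * - tau A) *: h').
    have e1 : - alpha A = - (a * - tau A) + - (Q A * s1) by rewrite /alpha; ring.
    have e2 : - beta A = - (Q A * t1) + b * - tau A by rewrite /beta; ring.
    by rewrite /A2 e1 e2 -vD -h'D !mulmxA.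
  exists (logm A2).
    apply/UP; split; first (apply/U1P; split).
    - by apply/gG; apply: lie_logm.
    - by rewrite A2E xi_act // subrr.
    rewrite eta_act // -/(Q A) /alpha /beta.
    have -> : Q A + b * - (Q A * s1 - a * tau A) + a * - (Q A * t1 + b * tau A)
      = Q A * (1 - (b * s1 + a * t1)) by ring.
    by rewrite st1 subrr mulr0.
  rewrite logmK; last exact: group_above_diag GA2.
  by rewrite /A2 -conj_h !mulmxA -!(mulmxA _ B0 A0) BA0 !mulmx1.
have params s t u : u \in U ->
    let A := expm (s *: v) *m (expm u *m A0) *m expm (t *: h) in
    alpha A = s /\ beta A = t.
  move=> uU A; have [/U1P[ug xi_u] eta_u] := iffLR (UP u) uU.
  have Gu := g_expm ug; have hu := g_above ug.
  have AB : A *m B0 = expm (s *: v) *m expm u *m expm (t *: h').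
    by rewrite /A -conj_h !mulmxA.
  have QA : Q A = b * s + a * t by rewrite /Q AB eta_act // expmK // eta_u add0r.
  (* Cramer's rule for (s, t) = Q (s1, t1) + tau0 (-a, b), a system of determinant b s1 + a t1 =
     1. *)
  pose tau0 := s1 * t - t1 * s.
  have sE : s = Q A * s1 - a * tau0.
    apply/eqP; rewrite -subr_eq0 QA /tau0.
    have -> : s - ((b * s + a * t) * s1 - a * (s1 * t - t1 * s))
      = s * (1 - (b * s1 + a * t1)) by ring.
    by rewrite st1 subrr mulr0.
  have tE : t = Q A * t1 + b * tau0.
    apply/eqP; rewrite -subr_eq0 QA /tau0.
    have -> : t - ((b * s + a * t) * t1 + b * (s1 * t - t1 * s))
      = t * (1 - (b * s1 + a * t1)) by ring.
    by rewrite st1 subrr mulr0.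
  suff tauA : tau A = tau0 by rewrite /alpha /beta tauA -sE -tE.
  rewrite /tau AB !mulmxA vD -[X in logm X]mulmxA h'D.
  have -> : - (Q A * s1) + s = - (a * tau0) by rewrite [in X in _ + X]sE addKr.
  have -> : t + - (Q A * t1) = b * tau0 by rewrite [in X in X + _]tE addrC addKr.
  by rewrite xi_act // expmK // xi_u add0r.
(* Exponential and logarithm being polynomial, so are [alpha] and [beta]; this makes the inverse a
   morphism. *)
have tau_poly (T : Type) (P : (T -> K) -> Prop) (F : T -> 'M[K]_n) :
    fun_subalg P -> mx_entries P F ->
    P (fun x => alpha (F x)) /\ P (fun x => beta (F x)).
  move=> sa PF.
  have PFB : mx_entries P (fun x => F x *m B0).
    by apply: (mx_entriesM sa) => //; apply: (mx_entries_cst sa).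
  have PQ : P (fun x => Q (F x)).
    by apply: (mx_entries_scalar sa eta_lin); apply: (mx_entries_logm sa).
  have PQc c : P (fun x => Q (F x) * c).
    by apply: (fun_subalgM sa) => //; exact: (fun_subalg_cst sa).
  have Pexp c (M : 'M[K]_n) : mx_entries P (fun x => expm (- (Q (F x) * c) *: M)).
    apply: (mx_entries_expm sa) => //; apply: (mx_entriesZ sa) => //.
      exact: (fun_subalgN sa).
    exact: (mx_entries_cst sa).
  have Ptau c : P (fun x => c * tau (F x)).
    apply: (fun_subalgM sa) => //; first exact: (fun_subalg_cst sa).
    apply: (mx_entries_scalar sa xi_lin); apply: (mx_entries_logm sa).
    by apply: (mx_entriesM sa) => //; apply: (mx_entriesM sa).
  split; first by apply: (fun_subalgD sa) => //; apply: (fun_subalgN sa).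
  exact: (fun_subalgD sa).
exists U, A0, B0; split=> //; split.
- by move=> _ [u uU <-]; apply: groupM => //; apply: g_expm; apply: Ug.
- exact: exp_translate_algebraic U_above AB0.
have slice_poly : polymap (@slice_map K n).
  have sa := polyfun_subalg K (n * n + (n * n + n * n)); have pid := @polyfun_id K.
  apply: mx_entries_linear_mx => //; apply: mx_entriesM => //; first apply: mx_entriesM => //.
  - apply: mx_entries_linear_mx => //; exact: mx_entries_linear_mx.
  - apply: mx_entries_linear_mx => //; apply: mx_entries_linear_mx => //.
    exact: mx_entries_linear_mx.
  apply: mx_entries_linear_mx => //; apply: mx_entries_linear_mx => //.
  exact: mx_entries_linear_mx.
have prodP (x : 'rV[K]_(n * n + (n * n + n * n))) :
    affine_prod (mxset V) (affine_prod (mxset (exp_translate U A0)) (mxset H)) x ->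
    exists s u t, u \in U /\ x = row_mx (mxvec (expm (s *: v)))
      (row_mx (mxvec (expm u *m A0)) (mxvec (expm (t *: h)))).
  move=> [[_ /VE[s ->] xV] [[_ [u uU <-] xS] [_ /HE[t ->] xH]]].
  exists s, u, t; split=> //.
  by rewrite xV xS xH !hsubmxK.
have slice_mapE s t (M : 'M[K]_n) : slice_map (row_mx (mxvec (expm (s *: v)))
    (row_mx (mxvec M) (mxvec (expm (t *: h))))) =
    mxvec (expm (s *: v) *m M *m expm (t *: h)).
  by rewrite /slice_map !row_mxKr !row_mxKl !mxvecK.
split.
  apply: polymap_variety_morphism => // x /prodP[s [u [t [uU ->]]]].
  rewrite slice_mapE; exists (expm (s *: v) *m (expm u *m A0) *m expm (t *: h)) => //.
  apply: groupM => //; apply: groupM => //; apply: groupM => //.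
  by apply: g_expm; apply: Ug.
(* The V- and H-components are read off from [alpha] and [beta]; removing them leaves the component
   in the slice. *)
pose inv (y : 'rV[K]_(n * n)) := let A := vec_mx y in
  row_mx (mxvec (expm (alpha A *: v)))
    (row_mx (mxvec (expm (- alpha A *: v) *m A *m expm (- beta A *: h)))
      (mxvec (expm (beta A *: h)))).
exists inv; split.
- apply: polymap_variety_morphism => [|_ [A GA <-]].
    have sa := polyfun_subalg K (n * n).
    have pvec : mx_entries (@polyfun K (n * n)) (fun y => vec_mx y : 'M[K]_n).
      by apply: mx_entries_linear_mx => //; exact: polyfun_id.
    have [pa pb] := tau_poly _ _ _ sa pvec.
    have pexp f (M : 'M[K]_n) : polyfun f -> mx_entries (@polyfun K (n * n))
        (fun y => expm (f y *: M)).
      move=> pf; apply: mx_entries_expm => //; apply: mx_entriesZ => //.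
      exact: mx_entries_cst.
    apply: mx_entries_row_mx => //.
      by apply: mx_entries_linear_mx => //; apply: pexp.
    apply: mx_entries_row_mx => //; last first.
      by apply: mx_entries_linear_mx => //; apply: pexp.
    apply: mx_entries_linear_mx => //; apply: mx_entriesM => //.
      apply: mx_entriesM => //; apply: pexp; exact: fun_subalgN.
    by apply: pexp; apply: fun_subalgN.
  rewrite /inv mxvecK; have [u uU AE] := slice_mem _ GA; split=> /=.
    by rewrite row_mxKl; exists (expm (alpha A *: v)) => //; apply/VE; eexists.
  rewrite row_mxKr; split; first rewrite row_mxKl.
    by exists (expm u *m A0); [exists u | rewrite AE].
  by rewrite row_mxKr; exists (expm (beta A *: h)) => //; apply/HE; eexists.
- move=> x /prodP[s [u [t [uU ->]]]]; rewrite slice_mapE /inv mxvecK.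
  have [-> ->] := params s t u uU.
  by rewrite -[expm (s *: v) *m _ *m _]mulmxA shift_v shift_h.
move=> _ [A GA <-]; rewrite /inv mxvecK slice_mapE.
rewrite !mulmxA vD subrr scale0r expm0 mul1mx.
by rewrite -mulmxA hD addNr scale0r expm0 mulmx1.
Qed.

End GlobalSlice.

(** * From the group-theoretic hypotheses to the slice *)

Section SliceTheorem.
Local Open Scope classical_set_scope.
Local Open Scope ring_scope.
Variables (K : numFieldType) (n : nat).

(** The logarithm identifies G with the linear space g, so the Krull dimension is the linear one. *)
Lemma unipotent_group_dim (G : set 'M[K]_n) (g : {vspace 'M[K]_n}) d :
  unipotent_group G -> (forall X, X \in g <-> lie G X) ->
  has_dim (mxset G) d -> d = \dim g.
Proof.
move=> hG gG; rewrite [in mxset _](group_exp_translate hG gG).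
by apply: exp_translate_dim (mulmx1 _) d => X /gG[].
Qed.

Lemma algebraic_subgroup_unipotent (H G : set 'M[K]_n) :
  unipotent_group G -> algebraic_subgroup H G -> unipotent_group H.
Proof. by move=> [_ GU] [aH HG]; split=> // A /HG /GU. Qed.

Lemma one_parameter_group (V G : set 'M[K]_n) (g : {vspace 'M[K]_n}) :
  unipotent_group G -> (forall X, X \in g <-> lie G X) ->
  algebraic_subgroup V G -> has_dim (mxset V) 1 ->
  exists v, [/\ v != 0, v \in g & forall A, V A <-> exists t, A = expm (t *: v)].
Proof.
move=> hG gG hVG dV; have hV := algebraic_subgroup_unipotent hG hVG.
have [gV gVP] := lie_vspace hV.
have [v v0 gvE] := dim1_vline (esym (unipotent_group_dim hV gVP dV)).
exists v; split=> //; last exact: expm_line (group_exp_translate hV gVP) gvE.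
have /gVP[hv Vv] : v \in gV by rewrite gvE memv_line.
by apply/gG; split=> // t; apply: hVG.2.
Qed.

Theorem unipotent_global_slice (G V H : set 'M[K]_n) d :
  unipotent_group G -> algebraic_subgroup V G -> algebraic_subgroup H G ->
  has_dim (mxset V) 1 -> has_dim (mxset H) 1 -> free_action V H G ->
  has_dim (mxset G) d ->
  exists S, global_slice V H G S /\ isomorphic (mxset S) [set: 'rV[K]_(d - 2)].
Proof.
move=> hG hV hH dV dH free dG; have [g gG] := lie_vspace hG.
have [v [v0 vg VE]] := one_parameter_group hG gG hV dV.
have [h [h0 hg HE]] := one_parameter_group hG gG hH dH.
have g_above X : X \in g -> above_diag 1 X by move=> /gG[].
have expm_eq1 c (X : 'M[K]_n) : X \in g -> X != 0 -> expm (c *: X) = 1%:M -> c = 0.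
  move=> Xg X0 e; have : c *: X = 0.
    apply: expm_inj; [exact/above_diagZ/g_above|exact: above_diag0|].
    by rewrite e expm0.
  by move/eqP; rewrite scaler_eq0 (negbTE X0) orbF => /eqP.
(* As N_n = 0, the congruence is the equality b A h B = a v. Exponentiated, it says that (exp(a v),
   exp(b h)) fixes A, so both exponentials are 1. *)
have fn : free_mod G v h n.
  move=> A B GA GB AB a b /(above_diag_eq0 (leqnn n))/eqP.
  rewrite subr_eq0 => /eqP bE.
  have Hb : H (expm (b *: h)) by apply/HE; exists b.
  have Hu : expm (b *: h) \in unitmx by case: hH => -[[Hu _ _ _] _] _; apply: Hu.
  have [||e1 e2] := free (expm (a *: v)) (expm (b *: h)) A _ Hb GA.
  - by apply/VE; exists a.
  - rewrite /two_sided_act -bE scalemxAl scalemxAr -mulmx_expm_conj //.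
      by rewrite -!mulmxA (mulmxA B) (mulmx1C AB) mul1mx mulmxV // mulmx1.
    exact: mulmx1C.
  by split; [exact: expm_eq1 e1|exact: expm_eq1 e2].
have [U [A0 [B0 [dimU U_above AB0 slice]]]] := global_slice_exists hG gG vg hg VE HE fn.
exists (exp_translate U A0); split=> //.
(* Here d is [\dim U] + 2, so the truncated subtraction [d - 2] is exact. *)
rewrite (unipotent_group_dim hG gG dG) dimU subSS subSS subn0.
exact: exp_translate_isomorphic U_above AB0.
Qed.

End SliceTheorem.

Theorem mainTheorem4 (R : realType) (n : nat) (G V H : set 'M[Cplx R]_n)
  (d : nat)
  (hG : unipotent_group G) (hGconn : connected G)
  (hGsc : simply_connected R G)
  (hV : algebraic_subgroup V G) (hH : algebraic_subgroup H G)
  (hVdim : has_dim (mxset V) 1) (hHdim : has_dim (mxset H) 1)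
  (hfree : free_action V H G) (hGdim : has_dim (mxset G) d) :
  exists S : set 'M[Cplx R]_n,
    global_slice V H G S /\
    isomorphic (mxset S) [set: 'rV[Cplx R]_(d - 2)].
Proof. exact: unipotent_global_slice hG hV hH hVdim hHdim hfree hGdim. Qed.
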